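(* Let $q$ be a complex number with $0<|q|<1$ and let $a,c,u,v,x,y$ be complex numbers with $\max\{|qv/y|,\,|u|,\,|q/(cu)|\}<1$. Put $$\rho(y)=\frac yq\cdot\frac{\left(x,\ \frac{xu}{v},\ \frac{q}{cu},\ \frac{q}{cv},\ \frac{yau}{q},\ \frac{avq}{y},\ \frac{xq}{yacuv},\ \frac{xy}{acv^2q};q\right)_\infty}{\left(\frac{xq}{y},\ \frac{xyu}{vq},\ \frac{q^2}{ycu},\ \frac{y}{cv},\ au,\ av,\ \frac{x}{acuv},\ \frac{x}{acv^2};q\right)_\infty},$$ $$\omega(y)=\frac{u}{cu-1}\cdot\frac{\left(x,\ \frac{xu}{cv},\ \frac1{cu},\ \frac q{cv};q\right)_\infty}{\left(\frac{xq}{y},\ \frac{xuq}{ycv},\ \frac{q}{ycu},\ \frac{y}{cv};q\right)_\infty}.$$ Then $$v\sum_{k=0}^{\infty}\frac{\left(\frac qu,acuv;q\right)_kv^k}{(av,cv;q)_{k+1}}\cdot\frac{\left(x,y,\frac{x}{av},\frac{x}{cv};q\right)_k(1-q^{2k}x)}{\left(q,xu,\frac{xq}{y};q\right)_k\left(\frac{x}{acuv};q\right)_{k+1}}\left(\frac qy\right)^k$$ $$-u\,\rho(y)\sum_{k=0}^{\infty}\frac{\left(\frac yv,acuv;q\right)_ku^k}{\left(\frac{yau}{q},\frac{ycu}{q};q\right)_{k+1}}\cdot\frac{\left(\frac{xyu}{vq},y,\frac{x}{av},\frac{x}{cv};q\right)_k\left(1-q^{2k-1}\frac{xyu}{v}\right)}{\left(q,xu,\frac{xu}{v};q\right)_k\left(\frac{xy}{acv^2q};q\right)_{k+1}}$$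 $$=\frac{\omega(y)\left(acuv,\ cuv,\ y,\ \frac{yu}{v},\ \frac{vq}{yu},\ \frac{auvq}{y},\ \frac{x}{av},\ \frac{xq}{ycv},\ \frac{xq}{yacv};q\right)_\infty}{\left(u,\ au,\ av,\ cv,\ xu,\ ycu,\ \frac{vq}{y},\ \frac{x}{acuv},\ \frac{x}{acv^2};q\right)_\infty}\;{}_8W_7\!\left(\frac{xu}{ycv};\frac qy,\frac{xu}{y},\frac{x}{acv^2},u,au;q,\frac{q}{cu}\right).$$
   Context: Notation. $(x;q)_\infty=\prod_{i=0}^\infty(1-xq^i)$; for a nonnegative integer $n$, $(x;q)_n=(x;q)_\infty/(xq^n;q)_\infty=\prod_{i=0}^{n-1}(1-xq^i)$. For several parameters, $(x_1,\dots,x_r;q)_m=(x_1;q)_m\cdots(x_r;q)_m$ ($m$ an integer $\ge 0$ or $\infty$). The very-well-poised series ${}_8W_7(\alpha;\beta_1,\dots,\beta_5;q,z)$ is $$\sum_{k=0}^\infty\frac{(\alpha,q\sqrt\alpha,-q\sqrt\alpha,\beta_1,\dots,\beta_5;q)_k}{(q,\sqrt\alpha,-\sqrt\alpha,\alpha q/\beta_1,\dots,\alpha q/\beta_5;q)_k}z^k,\qquad\text{where }\frac{(q\sqrt\alpha,-q\sqrt\alpha;q)_k}{(\sqrt\alpha,-\sqrt\alpha;q)_k}=\frac{1-\alpha q^{2k}}{1-\alpha}.$$ Standing convention: the parameters are such that every expression occurring is well defined (no denominator vanishes, including the denominator factors of the terms of the series). *)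

(* Defs.v *)
From HB Require Import structures.
From mathcomp Require Import all_boot all_order all_algebra.
From mathcomp Require Import complex.
From mathcomp Require Import all_classical all_reals all_analysis.

Set Implicit Arguments.
Unset Strict Implicit.
Unset Printing Implicit Defensive.

Import Order.TTheory GRing.Theory Num.Theory.
Import numFieldNormedType.Exports.

Local Open Scope ring_scope.
Local Open Scope classical_set_scope.

(* The definitions are over a generic [numFieldType] (or [numClosedFieldType],
   for the square root) because that is where the library puts the topology of
   the norm; they are meant to be used at [R[i]] with [R : realType]. *)

Definition qpoch (C : numFieldType) (x q : C) (n : nat) : C :=
  \prod_(0 <= i < n) (1 - x * q ^+ i).

Definition qpochoo (C : numFieldType) (x q : C) : C :=
  \big[*%R/1]_(0 <= i <oo) (1 - x * q ^+ i).

Definition qpochs (C : numFieldType) (xs : seq C) (q : C) (n : nat) : C :=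
  \prod_(x <- xs) qpoch x q n.

Definition qpochsoo (C : numFieldType) (xs : seq C) (q : C) : C :=
  \prod_(x <- xs) qpochoo x q.

(* [limn] has a junk value on divergent sequences, so a statement about
   [sumoo f] should come with [summable_seq f]. *)
Definition sumoo (C : numFieldType) (f : nat -> C) : C :=
  \big[+%R/0]_(0 <= k <oo) f k.

Definition summable_seq (C : numFieldType) (f : nat -> C) : Prop :=
  cvgn (fun n => \sum_(0 <= k < n) f k).

Section VeryWellPoised.
Variable C : numClosedFieldType.
Implicit Types (alpha q z : C) (k : nat).

Definition W87_num alpha (b1 b2 b3 b4 b5 : C) q k : C :=
  qpochs [:: alpha; q * sqrtC alpha; - (q * sqrtC alpha); b1; b2; b3; b4; b5]
    q k.

Definition W87_den alpha (b1 b2 b3 b4 b5 : C) q k : C :=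
  qpochs [:: q; sqrtC alpha; - sqrtC alpha; alpha * q / b1; alpha * q / b2;
             alpha * q / b3; alpha * q / b4; alpha * q / b5] q k.

Definition W87_term alpha (b1 b2 b3 b4 b5 : C) q z k : C :=
  W87_num alpha b1 b2 b3 b4 b5 q k / W87_den alpha b1 b2 b3 b4 b5 q k * z ^+ k.

Definition W87 alpha (b1 b2 b3 b4 b5 : C) q z : C :=
  sumoo (W87_term alpha b1 b2 b3 b4 b5 q z).

End VeryWellPoised.

Section Coefficients.
Variable C : numFieldType.
Variables q a c u v x y : C.

Definition rho_num : C :=
  qpochsoo [:: x; x * u / v; q / (c * u); q / (c * v); y * a * u / q;
               a * v * q / y; x * q / (y * a * c * u * v);
               x * y / (a * c * v ^+ 2 * q)] q.

Definition rho_den : C :=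
  qpochsoo [:: x * q / y; x * y * u / (v * q); q ^+ 2 / (y * c * u);
               y / (c * v); a * u; a * v; x / (a * c * u * v);
               x / (a * c * v ^+ 2)] q.

Definition rho : C := y / q * (rho_num / rho_den).

Definition omega_num : C :=
  qpochsoo [:: x; x * u / (c * v); 1 / (c * u); q / (c * v)] q.

Definition omega_den : C :=
  qpochsoo [:: x * q / y; x * u * q / (y * c * v); q / (y * c * u);
               y / (c * v)] q.

Definition omega : C := u / (c * u - 1) * (omega_num / omega_den).

Definition lhs1_den1 (k : nat) : C := qpochs [:: a * v; c * v] q k.+1.

Definition lhs1_den2 (k : nat) : C :=
  qpochs [:: q; x * u; x * q / y] q k * qpoch (x / (a * c * u * v)) q k.+1.

Definition lhs1_term (k : nat) : C :=
  (qpochs [:: q / u; a * c * u * v] q k * v ^+ k) / lhs1_den1 k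
  * ((qpochs [:: x; y; x / (a * v); x / (c * v)] q k
      * (1 - q ^+ (2 * k) * x)) / lhs1_den2 k)
  * (q / y) ^+ k.

Definition lhs2_den1 (k : nat) : C :=
  qpochs [:: y * a * u / q; y * c * u / q] q k.+1.

Definition lhs2_den2 (k : nat) : C :=
  qpochs [:: q; x * u; x * u / v] q k
  * qpoch (x * y / (a * c * v ^+ 2 * q)) q k.+1.

(* The exponent [2k - 1] is an integer: it is [-1] at [k = 0]. *)
Definition lhs2_term (k : nat) : C :=
  (qpochs [:: y / v; a * c * u * v] q k * u ^+ k) / lhs2_den1 k
  * ((qpochs [:: x * y * u / (v * q); y; x / (a * v); x / (c * v)] q k
      * (1 - q ^ ((2 * k)%:Z - 1) * (x * y * u / v))) / lhs2_den2 k).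

Definition rhs_num : C :=
  qpochsoo [:: a * c * u * v; c * u * v; y; y * u / v; v * q / (y * u);
               a * u * v * q / y; x / (a * v); x * q / (y * c * v);
               x * q / (y * a * c * v)] q.

Definition rhs_den : C :=
  qpochsoo [:: u; a * u; a * v; c * v; x * u; y * c * u; v * q / y;
               x / (a * c * u * v); x / (a * c * v ^+ 2)] q.

End Coefficients.

(* Main.v *)
(* The three series are the two-point q-integrals, over the three pairs of points
   chosen from A = qv/y, B = cuv and S = u, of one and the same integrand
     (qt/A, qt/B, qt/S, Dt; q)_oo / (Et, Ft, Gt, t; q)_oo,
   with D = x/(cv), E = y/(cuv), F = a, G = x/(acuv^2); the three-term relation is
   then the additivity of the integral.  Each two-point integral is evaluated as a
   very-well-poised series by expanding (ct, dt)/(ht) with the nonterminating 6phi5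
   sum in the functions (b/t; q)_k t^k, which turn the integral over [a, b] into the
   Al-Salam--Verma integral over [a, b q^k].  The 6phi5 sum and the Al-Salam--Verma
   integral are obtained by a q-shift of their parameters (a telescoping sum)
   followed by a passage to the limit.  All sums are normalized by infinite products
   so that no denominator depends on the parameters: the identities then hold
   without genericity assumptions, also where some of the products vanish. *)
Require Import Defs.
From HB Require Import structures.
From mathcomp Require Import all_boot all_order all_algebra.
From mathcomp Require Import complex ring.
From mathcomp Require Import all_classical all_reals all_analysis.

Set Implicit Arguments.
Unset Strict Implicit.
Unset Printing Implicit Defensive.

Import Order.TTheory GRing.Theory Num.Theory.
Import numFieldNormedType.Exports.

Local Open Scope ring_scope.
Local Open Scope complex_scope.

(** * Geometrically dominated series *)

(** The obstacle is convergence. The 6phi5 sum that expands (ct, dt)/(ht) has argument th. At the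
    points t = a q^i the condition |ah| < 1 suffices, but nothing bounds |bh| (b may be B = cuv), so
    at the points b q^i the expansion is used only as a terminating sum, which is proved separately
    by another recurrence. The choice of the factor ht fixes the argument ah of the resulting
    series: h = 1 on the pairs (A, B) and (S, B) gives A = qv/y and S = u, while h = E on (A, S)
    gives AE = q/(cu). These are the three moduli assumed to be less than 1. On each pair the third
    point p enters through the numerator qt/p, so c = q/p, and the condition cd = abefgh is for all
    three pairs the single relation qD = ABSEFG. It makes cd/h equal to abefg, which is what brings
    the expanded integrals into Al-Salam--Verma form. *)

Definition dominated (C : numFieldType) (M r : C) (f : nat -> C) :=
  [/\ 0 <= M, 0 <= r, r < 1 & forall k, `|f k| <= M * r ^+ k].

(** The only form of completeness that the argument uses. Taken as a hypothesis on the field, it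
    lets everything up to the last theorem run over a generic field. *)
Definition geo_complete (C : numFieldType) :=
  forall (M r : C) f, dominated M r f ->
    cvgn (fun n => \sum_(0 <= k < n) f k).

(** * Completeness of the complex numbers *)

Section ComplexCompleteness.
Local Open Scope classical_set_scope.
Variable R : realType.
Local Notation C := (R[i] : numFieldType).

Lemma cvg_real_complex (u : nat -> R) (l : R) :
  u @ \oo --> l -> ((fun n => (u n)%:C) : nat -> C) @ \oo --> (l%:C : C).
Proof.
move=> /cvgrPdist_lt ul; apply/cvgrPdist_lt => e e0.
have er : e \is Num.real by exact: gtr0_real.
have e0' : 0 < complex.Re e by move: e0; rewrite -(RRe_real er) ltcR.
near=> n.
rewrite -rmorphB /= -(RRe_real er) normc_def /= expr0n addr0 sqrtr_sqr ltcR.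
by near: n; exact: ul.
Unshelve. all: by end_near. Qed.

(** Comparison test on real and imaginary parts. [M] and [r] are nonnegative complex numbers, hence
    images of reals, which puts the geometric majorant in [R]. *)
Lemma complex_geo_complete : geo_complete C.
Proof.
move=> M r f [M0 r0 r1 fM].
have [m Mm] : exists m, M = m%:C by apply/complex_realP/ger0_real.
have [s rs] : exists s, r = s%:C by apply/complex_realP/ger0_real.
move: M0 r0 r1 fM; rewrite {}Mm {}rs ler0c ler0c ltcR => m0 s0 s1 fM.
have geo : cvgn (series (geometric m s)).
  by apply: is_cvg_geometric_series; rewrite ger0_norm.
have fM' k : ComplexField.Normc.normc (f k) <= geometric m s k.
  by rewrite /= -lecR; apply: le_trans (fM k) _; rewrite rmorphM rmorphXn.
have key (p : R[i] -> R) : (forall w, `|p w| <= ComplexField.Normc.normc w) ->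
    cvgn (series (p \o f)).
  move=> pn; apply: normed_cvg; apply: series_le_cvg geo => //= k.
    exact: le_trans (normr_ge0 _) (le_trans (pn _) (fM' k)).
  exact: le_trans (pn _) (fM' k).
have cR : cvgn (series (@complex.Re R \o f)).
  by apply: key => w; rewrite -lecR; exact: normc_ge_Re.
have cI : cvgn (series (@complex.Im R \o f)).
  apply: key => -[x y] /=; rewrite -sqrtr_sqr ler_wsqrtr //.
  by rewrite lerDr sqr_ge0.
apply/cvg_ex; exists ((limn (series (@complex.Re R \o f)))%:C
  + 'i%C * (limn (series (@complex.Im R \o f)))%:C).
rewrite (_ : (fun n => _) = (fun n => (series (@complex.Re R \o f) n)%:C
  + 'i%C * (series (@complex.Im R \o f) n)%:C)); last first.
  apply/funext => n; rewrite /series /= !rmorph_sum mulr_sumr -big_split /=.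
  by apply: eq_bigr => k _; rewrite -complexE.
apply: (@cvgD C); first exact: cvg_real_complex.
by apply: (@cvgMl_tmp C); exact: cvg_real_complex.
Qed.

End ComplexCompleteness.

Section GeometricDomination.
Local Open Scope classical_set_scope.
Variable C : numFieldType.
Hypothesis dominated_cvg : geo_complete C.
Implicit Types (f g : nat -> C) (M r z : C).

Lemma dominated_lim M r f : dominated M r f ->
  (fun n => \sum_(0 <= k < n) f k) @ \oo --> sumoo f.
Proof. by move=> /dominated_cvg. Qed.

Lemma cvg_exprn0 z : `|z| < 1 -> (fun n => z ^+ n) @ \oo --> (0 : C).
Proof.
move=> z1; apply: cvg_series_cvg_0.
apply: (@dominated_cvg 1 `|z|); split => // k.
by rewrite mul1r normrX.
Qed.

Lemma cvg_eq_limn (u : nat -> C) (l : C) : u @ \oo --> l -> limn u = l.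
Proof. by move=> ul; apply/cvg_lim. Qed.

Lemma cvgn_unique (u : nat -> C) (l l' : C) :
  u @ \oo --> l -> u @ \oo --> l' -> l = l'.
Proof. by move=> /cvg_eq_limn <- /cvg_eq_limn. Qed.

Lemma lim_norm_le (u : nat -> C) (l B : C) : 0 <= B ->
  (\forall n \near \oo, `|u n| <= B) -> u @ \oo --> l -> `|l| <= B.
Proof.
move=> B0 uB ul; rewrite real_leNgt ?ger0_real //; apply/negP => Bl.
have e0 : 0 < `|l| - B by rewrite subr_gt0.
have /cvgrPdist_lt/(_ _ e0) near_l := ul.
near \oo => n.
have h1 : `|l - u n| < `|l| - B by near: n.
have h2 : `|u n| <= B by near: n.
suff : `|l| < `|l| by rewrite ltxx.
apply: le_lt_trans (_ : `|l - u n| + `|u n| < _).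
  by rewrite -{1}(subrK (u n) l) ler_normD.
by rewrite -ltrBrDr; apply: lt_le_trans h1 _; rewrite lerD2l lerN2.
Unshelve. all: by end_near. Qed.

Lemma sum_geometric_le r n : 0 <= r -> r < 1 ->
  \sum_(0 <= k < n) r ^+ k <= (1 - r)^-1.
Proof.
move=> r0 r1; have r1' : 0 < 1 - r by rewrite subr_gt0.
rewrite -[leRHS]mul1r ler_pdivlMr // mulrC big_mkord.
by rewrite -[1 - r]opprB mulNr -subrX1 opprB gerBl exprn_ge0.
Qed.

Lemma dominated_partial_le M r f n : dominated M r f ->
  `|\sum_(0 <= k < n) f k| <= M / (1 - r).
Proof.
move=> [M0 r0 r1 fM]; apply: le_trans (ler_norm_sum _ _ _) _.
apply: le_trans (_ : \sum_(0 <= k < n) M * r ^+ k <= _); first exact: ler_sum.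
by rewrite -mulr_sumr ler_wpM2l ?sum_geometric_le.
Qed.

Lemma dominated_sumoo_le M r f : dominated M r f -> `|sumoo f| <= M / (1 - r).
Proof.
move=> df; have [M0 r0 r1 _] := df.
have B0 : 0 <= M / (1 - r) by rewrite divr_ge0 ?subr_ge0 ?(ltW r1).
apply: (lim_norm_le B0 _ (dominated_lim df)).
by near=> n; exact: dominated_partial_le.
Unshelve. all: by end_near. Qed.

Lemma dominated_shift M r f n : dominated M r f ->
  dominated (M * r ^+ n) r (fun k => f (n + k)%N).
Proof.
move=> [M0 r0 r1 fM]; split => // [|k]; first by rewrite mulr_ge0 ?exprn_ge0.
by rewrite -mulrA -exprD.
Qed.

Lemma sumoo_split M r f n : dominated M r f ->
  sumoo f = \sum_(0 <= k < n) f k + sumoo (fun k => f (n + k)%N).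
Proof.
move=> df.
have /dominated_lim h := dominated_shift n df.
have h1 : (fun m => \sum_(0 <= k < n + m) f k) @ \oo --> sumoo f.
  exact: cvg_comp (@cvg_addnl n) (dominated_lim df).
apply: (cvgn_unique h1).
rewrite (_ : (fun m => _) = (fun m => \sum_(0 <= k < n) f k
   + \sum_(0 <= k < m) f (n + k)%N)).
  by apply: cvgD => //; exact: cvg_cst.
apply/funext => m; rewrite (big_cat_nat (n := n)) ?leq_addr //=; congr (_ + _).
by rewrite -{1}[n]add0n big_addn addKn; apply: eq_bigr => k _; rewrite addnC.
Qed.

Lemma dominatedZ M r f c : dominated M r f ->
  dominated (`|c| * M) r (fun k => c * f k).
Proof.
move=> [M0 r0 r1 fM]; split => // [|k]; first by rewrite mulr_ge0.
by rewrite normrM -mulrA ler_wpM2l.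
Qed.

Lemma sumooZ M r f c : dominated M r f ->
  sumoo (fun k => c * f k) = c * sumoo f.
Proof.
move=> df; apply: (cvgn_unique (dominated_lim (dominatedZ c df))).
under eq_fun do rewrite -mulr_sumr.
by apply: cvgMl_tmp; exact: (dominated_lim df).
Qed.

Lemma sumooB M r f M' r' g : dominated M r f -> dominated M' r' g ->
  (fun n => \sum_(0 <= k < n) (f k - g k)) @ \oo --> sumoo f - sumoo g.
Proof.
move=> df dg; under eq_fun do rewrite sumrB.
by apply: cvgB; [exact: (dominated_lim df)|exact: (dominated_lim dg)].
Qed.

Lemma eq_sumoo f g : f =1 g -> sumoo f = sumoo g.
Proof. by move=> fg; congr sumoo; apply/funext. Qed.

Lemma telescope_sumoo M r f M' r' g c (G : nat -> C) (l : C) :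
  dominated M r f -> dominated M' r' g ->
  (forall k, f k - c * g k = G k.+1 - G k) -> G @ \oo --> l ->
  sumoo f - c * sumoo g = l - G 0%N.
Proof.
move=> df dg fgG Gl; rewrite -(sumooZ c dg).
apply: (cvgn_unique (sumooB df (dominatedZ c dg))).
under eq_fun do (under eq_bigr do rewrite fgG; rewrite telescope_sumr //).
by apply: cvgB => //; exact: cvg_cst.
Qed.

Lemma dominated_limit M r (F : nat -> nat -> C) g :
  (forall n, dominated M r (F n)) ->
  (forall k, F ^~ k @ \oo --> g k) -> dominated M r g.
Proof.
move=> dF Fg; have [M0 r0 r1 _] := dF 0%N; split => // k.
apply: (lim_norm_le _ _ (Fg k)); first by rewrite mulr_ge0 ?exprn_ge0.
by near=> n; have [_ _ _] := dF n.
Unshelve. all: by end_near. Qed.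

(** Dominated convergence: the tails beyond K cost at most 2e/3, uniformly in n, and the first K
    terms converge one by one. *)
Lemma tannery M r (F : nat -> nat -> C) g :
  (forall n, dominated M r (F n)) ->
  (forall k, F ^~ k @ \oo --> g k) ->
  (fun n => sumoo (F n)) @ \oo --> sumoo g.
Proof.
move=> dF Fg; have dg := dominated_limit dF Fg; have [M0 r0 r1 _] := dg.
have r1' : 0 < 1 - r by rewrite subr_gt0.
apply/cvgrPdist_lt => e e0.
have e30 : 0 < e / 3 by rewrite divr_gt0.
have [K KP] : exists K, M * r ^+ K / (1 - r) < e / 3.
  (* The added 1 keeps the divisor positive when [M] is 0. *)
  have c0 : 0 < M / (1 - r) + 1.
    by rewrite ltr_wpDl ?divr_ge0 // ltW.
  have /cvgrPdist_lt/(_ _ (divr_gt0 e30 c0)) nr : (fun n => r ^+ n) @ \oo --> 0.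
    by apply: cvg_exprn0; rewrite ger0_norm.
  near \oo => K; exists K.
  have : `|0 - r ^+ K| < e / 3 / (M / (1 - r) + 1) by near: K.
  rewrite sub0r normrN ger0_norm ?exprn_ge0 // ltr_pdivlMr // => h.
  apply: le_lt_trans h.
  rewrite mulrAC mulrC ler_wpM2l ?exprn_ge0 //.
  by rewrite lerDl.
have sl : (fun n => \sum_(0 <= k < K) F n k) @ \oo --> \sum_(0 <= k < K) g k.
  elim: (K) => [|k IH].
    by under eq_fun do rewrite big_nil; rewrite big_nil; exact: cvg_cst.
  under eq_fun do rewrite big_nat_recr //=.
  by rewrite big_nat_recr //=; apply: cvgD.
move/cvgrPdist_lt/(_ _ e30) : sl => sl.
near=> n.
rewrite (sumoo_split K dg) (sumoo_split K (dF n)).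
have h1 : `|\sum_(0 <= k < K) g k - \sum_(0 <= k < K) F n k| < e / 3.
  by near: n.
have h2 := dominated_sumoo_le (dominated_shift K dg).
have h3 := dominated_sumoo_le (dominated_shift K (dF n)).
rewrite opprD addrACA; apply: le_lt_trans (ler_normD _ _) _.
rewrite (_ : e = e / 3 + (e / 3 + e / 3)); last by field.
apply: ltrD => //; apply: le_lt_trans (ler_normB _ _) _.
by apply: ltrD; apply: le_lt_trans KP.
Unshelve. all: by end_near. Qed.

Lemma sumoo_sum (N : nat) (F : nat -> nat -> C) :
  (forall i, exists M r, dominated M r (F i)) ->
  (fun n => \sum_(0 <= k < n) \sum_(0 <= i < N) F i k) @ \oo -->
  \sum_(0 <= i < N) sumoo (F i).
Proof.
move=> dF; under eq_fun do rewrite exchange_big.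
suff: (fun n => \sum_(0 <= i < N) \sum_(0 <= k < n) F i k) @ \oo -->
  \sum_(0 <= i < N) sumoo (F i) by [].
elim: N => [|N IH].
  by under eq_fun do rewrite big_nil; rewrite big_nil; exact: cvg_cst.
under eq_fun do rewrite big_nat_recr //=.
rewrite big_nat_recr //=; apply: cvgD => //.
by have [M [r /dominated_lim]] := dF N.
Qed.

(** A finite sum over i commutes with the sum over k; [tannery], with the majorant M/(1 - r) s^k,
    then lets the number of values of i tend to infinity. *)
Lemma sumoo_exchange M r s (F : nat -> nat -> C) :
  0 <= M -> 0 <= r -> r < 1 -> 0 <= s -> s < 1 ->
  (forall i k, `|F i k| <= M * r ^+ i * s ^+ k) ->
  sumoo (fun i => sumoo (F i)) = sumoo (fun k => sumoo (F ^~ k)).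
Proof.
move=> M0 r0 r1 s0 s1 FM.
have r1' : 0 < 1 - r by rewrite subr_gt0.
have dk i : dominated (M * r ^+ i) s (F i).
  by split => //; rewrite mulr_ge0 ?exprn_ge0.
have di k : dominated (M * s ^+ k) r (F ^~ k).
  by split => // [|i]; rewrite 1?mulr_ge0 ?exprn_ge0 // mulrAC.
have d1 : dominated (M / (1 - s)) r (fun i => sumoo (F i)).
  split => // [|i]; first by rewrite divr_ge0 ?subr_ge0 ?(ltW s1).
  by rewrite mulrAC; exact: (dominated_sumoo_le (dk i)).
apply: (cvgn_unique (dominated_lim d1)).
have dN n : dominated (M / (1 - r)) s (fun k => \sum_(0 <= i < n) F i k).
  split => // [|k]; first by rewrite divr_ge0 // ltW.
  by rewrite mulrAC; exact: (dominated_partial_le n (di k)).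
rewrite (_ : (fun n => _) =
    (fun n => sumoo (fun k => \sum_(0 <= i < n) F i k))).
  by apply: (tannery dN) => k; exact: (dominated_lim (di k)).
apply/funext => n; apply/esym/(cvgn_unique (dominated_lim (dN n))).
by apply: sumoo_sum => i; exists (M * r ^+ i), s.
Qed.

End GeometricDomination.

(** * Infinite q-shifted factorials *)

Section QPochhammer.
Local Open Scope classical_set_scope.
Variable C : numFieldType.
Hypothesis C_complete : geo_complete C.
Variable q : C.
Hypothesis q_lt1 : `|q| < 1.
Implicit Types (x y z : C) (n k : nat).

Lemma qpoch0n x : qpoch x q 0 = 1.
Proof. by rewrite /qpoch big_nil. Qed.

Lemma qpochS x n : qpoch x q n.+1 = qpoch x q n * (1 - x * q ^+ n).
Proof. by rewrite /qpoch big_nat_recr. Qed.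

Lemma qpochSl x n : qpoch x q n.+1 = (1 - x) * qpoch (x * q) q n.
Proof.
rewrite /qpoch big_nat_recl // expr0 mulr1; congr (_ * _).
by apply: eq_bigr => i _; rewrite exprS mulrA.
Qed.

Lemma qpochD x m n : qpoch x q (m + n) = qpoch x q m * qpoch (x * q ^+ m) q n.
Proof.
elim: n => [|n IH]; first by rewrite addn0 qpoch0n mulr1.
by rewrite addnS !qpochS IH exprD !mulrA.
Qed.

Lemma qpoch0 n : qpoch 0 q n = 1.
Proof. by rewrite /qpoch big1 // => i _; rewrite mul0r subr0. Qed.

(** Choose K with 2 X r^K / (1 - r) at most 1. The product of the factors from K on is then at most
    1 + 2 T, where T is the sum of their increments: by induction, (1 + 2T)(1 + y) is at most 1 +
    2(T + y) because 2T is at most 1. The first K factors form [P]. *)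
Lemma prod_bound X r : 0 <= X -> 0 <= r -> r < 1 ->
  exists2 M : C, 0 < M & forall n, \prod_(0 <= i < n) (1 + X * r ^+ i) <= M.
Proof.
move=> X0 r0 r1; have r1' : 0 < 1 - r by rewrite subr_gt0.
have f0 Y i : 0 <= Y -> 0 <= 1 + Y * r ^+ i.
  by move=> Y0; rewrite addr_ge0 ?mulr_ge0 ?exprn_ge0.
have [K KP] : exists K, X * r ^+ K / (1 - r) * 2 <= 1.
  have c0 : 0 < X / (1 - r) * 2 + 1.
    by rewrite ltr_wpDl ?mulr_ge0 ?invr_ge0 // ltW.
  have /cvgrPdist_lt/(_ (X / (1 - r) * 2 + 1)^-1) nr :
    (fun n => r ^+ n) @ \oo --> 0.
    by apply: cvg_exprn0; rewrite ?ger0_norm.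
  have {nr} := nr; rewrite invr_gt0 => /(_ c0) nr.
  near \oo => K; exists K.
  have : `|0 - r ^+ K| < (X / (1 - r) * 2 + 1)^-1 by near: K.
  rewrite sub0r normrN ger0_norm ?exprn_ge0 //.
  rewrite -[ltRHS]mul1r ltr_pdivlMr // => /ltW; apply: le_trans.
  by rewrite -mulrA -mulrA mulrCA ler_wpM2l ?exprn_ge0 // mulrA lerDl.
pose Y := X * r ^+ K; have Y0 : 0 <= Y by rewrite mulr_ge0 ?exprn_ge0.
have tail n : \prod_(0 <= i < n) (1 + Y * r ^+ i) <= 2.
  have S n' : 2 * \sum_(0 <= i < n') Y * r ^+ i <= 1.
    apply: le_trans KP; rewrite -mulr_sumr mulrC ler_wpM2r //.
    by rewrite ler_wpM2l // sum_geometric_le.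
  apply: le_trans (_ : 1 + 2 * \sum_(0 <= i < n) Y * r ^+ i <= _); last first.
    by rewrite (_ : 2 = 1 + 1) // lerD2l.
  elim: n => [|n IH]; first by rewrite !big_nil mulr0 addr0.
  rewrite !big_nat_recr //=; apply: le_trans (ler_wpM2r (f0 _ _ Y0) IH) _.
  set T := \sum_(0 <= i < n) _; set y := Y * r ^+ n.
  have -> : (1 + 2 * T) * (1 + y) = 1 + 2 * T + y + 2 * T * y by ring.
  have -> : 1 + 2 * (T + y) = 1 + 2 * T + y + y by ring.
  by rewrite lerD2l ler_piMl ?S // mulr_ge0 ?exprn_ge0.
pose P := \prod_(0 <= i < K) (1 + X * r ^+ i).
have P1 : 1 <= P.
  rewrite /P; elim: (K) => [|k IH]; first by rewrite big_nil.
  rewrite big_nat_recr //= -[leLHS]mulr1 ler_pM //.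
  by rewrite lerDl mulr_ge0 ?exprn_ge0.
exists (P * 2) => [|n]; first by rewrite mulr_gt0 // (lt_le_trans ltr01).
apply: le_trans (_ : \prod_(0 <= i < K + n) (1 + X * r ^+ i) <= _).
  rewrite addnC; elim: (K) => [|k IH]; first by rewrite addn0.
  rewrite addnS big_nat_recr //=; apply: le_trans IH _.
  rewrite -[leLHS]mulr1 ler_wpM2l ?prodr_ge0 // => [i _|]; first exact: f0.
  by rewrite lerDl mulr_ge0 ?exprn_ge0.
rewrite (big_cat_nat (n := K)) ?leq_addr //= ler_wpM2l ?(le_trans ler01) //.
rewrite -{1}[K]add0n big_addn addKn; apply: le_trans (tail n).
by apply: ler_prod => i _; rewrite /Y -mulrA -exprD addnC lexx andbT f0.
Unshelve. all: by end_near. Qed.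

Lemma qpoch_bound X : 0 <= X -> exists2 M : C, 0 < M &
  forall x n, `|x| <= X -> `|qpoch x q n| <= M.
Proof.
move=> X0; have [M M0 MP] := prod_bound X0 (normr_ge0 q) q_lt1.
exists M => // x n xX; rewrite /qpoch normr_prod; apply: le_trans (MP n).
apply: ler_prod => i _; rewrite normr_ge0 /=.
apply: le_trans (ler_normB _ _) _; rewrite normr1 lerD2l normrM normrX.
by rewrite ler_wpM2r ?exprn_ge0.
Qed.

(** Turns the product into partial sums of a geometrically dominated series, so that convergence of
    infinite products follows from that of series. *)
Lemma qpoch_sum x n :
  qpoch x q n = 1 + \sum_(0 <= i < n) - x * qpoch x q i * q ^+ i.
Proof.
elim: n => [|n IH]; first by rewrite big_nil addr0 qpoch0n.
by rewrite big_nat_recr //= addrA -IH qpochS; ring.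
Qed.

(** The factor |x| is kept explicit: it makes (x;q)_oo - 1 of order |x|, whence the limit 1 along x
    q^N. *)
Lemma qpoch_diff_dominated X : 0 <= X -> exists2 M : C, 0 < M &
  forall x, `|x| <= X ->
    dominated (`|x| * M) `|q| (fun i => - x * qpoch x q i * q ^+ i).
Proof.
move=> /qpoch_bound[M M0 MP]; exists M => // x xX.
split => // [|i]; first by rewrite mulr_ge0 // ltW.
by rewrite !normrM normrN normrX ler_wpM2r ?exprn_ge0 // ler_wpM2l ?MP.
Qed.

Lemma qpoch_cvg x : (fun n => qpoch x q n) @ \oo --> qpochoo x q.
Proof.
have [M M0 /(_ x (lexx _)) d] := qpoch_diff_dominated (normr_ge0 x).
suff h : cvgn (fun n => qpoch x q n) by exact: h.
apply/cvg_ex; eexists; rewrite (eq_fun (qpoch_sum x)).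
by apply: cvgD; [exact: cvg_cst|exact: (dominated_lim C_complete d)].
Qed.

Lemma qpochoo_bound X : 0 <= X -> exists2 M : C, 0 < M &
  forall x, `|x| <= X -> `|qpochoo x q| <= M.
Proof.
move=> /qpoch_bound[M M0 MP]; exists M => // x xX.
apply: (lim_norm_le (ltW M0) _ (@qpoch_cvg x)).
by near=> n; exact: MP.
Unshelve. all: by end_near. Qed.

Lemma qpochoo_split x n : qpochoo x q = qpoch x q n * qpochoo (x * q ^+ n) q.
Proof.
have h : (fun m => qpoch x q (n + m)) @ \oo --> qpochoo x q.
  exact: cvg_comp (@cvg_addnl n) (@qpoch_cvg x).
apply: (cvgn_unique h); under eq_fun do rewrite qpochD.
by apply: cvgMl_tmp; exact: qpoch_cvg.
Qed.

Lemma qpochooS x : qpochoo x q = (1 - x) * qpochoo (x * q) q.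
Proof. by rewrite (qpochoo_split x 1) qpochS qpoch0n mul1r expr0 mulr1 expr1. Qed.

Lemma qpochoo0 : qpochoo 0 q = 1.
Proof.
apply: (cvgn_unique (@qpoch_cvg 0)); under eq_fun do rewrite qpoch0.
exact: cvg_cst.
Qed.

Lemma qpochoo1 : qpochoo 1 q = 0.
Proof. by rewrite qpochooS subrr mul0r. Qed.

Lemma qpoch_cvg1 x n : (fun N => qpoch (x * q ^+ N) q n) @ \oo --> (1 : C).
Proof.
elim: n => [|n IH]; first by under eq_fun do rewrite qpoch0n; exact: cvg_cst.
under eq_fun do rewrite qpochS.
have h : (fun N => 1 - x * q ^+ N * q ^+ n) @ \oo --> 1 - x * 0 * q ^+ n.
  apply: cvgB; first exact: cvg_cst.
  by apply: cvgMr_tmp; apply: cvgMl_tmp; exact: cvg_exprn0.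
have := cvgM IH h; rewrite mulr0 mul0r subr0 mulr1; exact.
Qed.

Lemma qpochoo_cvg1 x : (fun N => qpochoo (x * q ^+ N) q) @ \oo --> (1 : C).
Proof.
have [M M0 d] := qpoch_diff_dominated (normr_ge0 x).
have q1 : 0 < 1 - `|q| by rewrite subr_gt0.
have key y : `|y| <= `|x| -> `|qpochoo y q - 1| <= `|y| * M / (1 - `|q|).
  move=> /d dy; rewrite (_ : _ - 1 = sumoo (fun i => - y * qpoch y q i * q ^+ i)).
    exact: (dominated_sumoo_le C_complete dy).
  apply/eqP; rewrite subr_eq addrC; apply/eqP.
  apply: (cvgn_unique (@qpoch_cvg y)); rewrite (eq_fun (qpoch_sum y)).
  by apply: cvgD; [exact: cvg_cst|exact: (dominated_lim C_complete dy)].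
pose K := `|x| * M / (1 - `|q|).
have K0 : 0 <= K by rewrite divr_ge0 ?mulr_ge0 // ltW.
have bd N : `|qpochoo (x * q ^+ N) q - 1| <= K * `|q| ^+ N.
  apply: le_trans (key _ _) _.
    by rewrite normrM normrX ler_piMr // exprn_ile1 // ltW.
  by rewrite normrM normrX /K [leRHS]mulrAC [X in X / _]mulrAC.
apply/cvgrPdist_lt => e e0.
have K1 : 0 < K + 1 by rewrite ltr_wpDl.
have /cvgrPdist_lt/(_ _ (divr_gt0 e0 K1)) nr : (fun n => q ^+ n) @ \oo --> 0.
  exact: cvg_exprn0.
near=> N.
rewrite distrC; apply: le_lt_trans (bd N) _.
have : `|0 - q ^+ N| < e / (K + 1) by near: N.
rewrite sub0r normrN normrX ltr_pdivlMr // mulrC; apply: le_lt_trans.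
by rewrite ler_wpM2r ?exprn_ge0 // lerDl.
Unshelve. all: by end_near. Qed.

(** A far tail is close to 1, hence nonzero, and the finitely many remaining factors do not vanish
    since |x q^i| < 1. *)
Lemma qpochoo_neq0 x : `|x| < 1 -> qpochoo x q != 0.
Proof.
move=> x1; have /cvgrPdist_lt/(_ _ ltr01) near1 := @qpochoo_cvg1 x.
near \oo => N.
have h : `|1 - qpochoo (x * q ^+ N) q| < 1 by near: N.
rewrite (qpochoo_split x N) mulf_neq0 //; last first.
  by apply: contraTneq h => ->; rewrite subr0 normr1 ltxx.
rewrite /qpoch prodf_seq_neq0; apply/allP => i _ /=.
rewrite subr_eq0; apply: contraTneq x1 => /(congr1 Num.norm).
rewrite normr1 normrM normrX => xq; rewrite le_gtF // xq.
by rewrite ler_piMr // exprn_ile1 // ltW.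
Unshelve. all: by end_near. Qed.

End QPochhammer.

(** * The Al-Salam--Verma q-integral *)

Section AlSalamVerma.
Local Open Scope classical_set_scope.
Variable C : numFieldType.
Hypothesis C_complete : geo_complete C.
Variable q : C.
Hypothesis q_neq0 : q != 0.
Hypothesis q_lt1 : `|q| < 1.
Implicit Types (x y z a b c d e f : C) (n k : nat).

Local Notation "x ^_ n" := (qpoch x q n).
Local Notation oo x := (qpochoo x q).

Lemma ler_normM x y X Y : `|x| <= X -> `|y| <= Y -> `|x * y| <= X * Y.
Proof. by move=> hx hy; rewrite normrM ler_pM. Qed.

Lemma normr_exprn_le x n : `|x * q ^+ n| <= `|x|.
Proof. by rewrite normrM normrX ler_piMr // exprn_ile1 // ltW. Qed.

Lemma qfactor_bound X : 0 <= X -> exists2 M : C, 0 < M &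
  forall x n, `|x| <= X -> `|x ^_ n| <= M /\ `|oo (x * q ^+ n)| <= M.
Proof.
move=> X0; have [M1 M10 h1] := qpoch_bound C_complete q_lt1 X0.
have [M2 M20 h2] := qpochoo_bound C_complete q_lt1 X0.
exists (M1 + M2) => [|x n xX]; first exact: addr_gt0.
split; first by rewrite (le_trans (h1 _ _ xX)) // lerDl ltW.
apply: le_trans (h2 _ (le_trans (normr_exprn_le _ _) xX)) _.
by rewrite lerDr ltW.
Qed.

(* The point [t = b q^i] of the q-integral of (qt/a, qt/b, ct)/(dt, et, ft) with
   c = abdef, multiplied by (bd, be, bf)_oo. *)
Definition av_term a b d e f i : C :=
  b * oo (q * q ^+ i) * oo (b * q / a * q ^+ i)
  * oo (a * b * d * e * f * b * q ^+ i)
  * ((b * d) ^_ i * (b * e) ^_ i * (b * f) ^_ i) * q ^+ i.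

Definition av_sum a b d e f : C := sumoo (av_term a b d e f).

(** The q-integral from a to b, multiplied by (ad, ae, af, bd, be, bf)_oo / (1 - q). *)
Definition av_diff a b d e f : C :=
  oo (a * d) * oo (a * e) * oo (a * f) * av_sum a b d e f
  - oo (b * d) * oo (b * e) * oo (b * f) * av_sum b a d e f.

(** Uniform in d on a disc, because the limit is later taken along d q^N. *)
Lemma av_dominated a b e f D : 0 <= D -> exists M : C,
  forall d, `|d| <= D -> dominated M `|q| (av_term a b d e f).
Proof.
move=> D0.
have [M1 M10 h1] := qfactor_bound (normr_ge0 q).
have [M2 M20 h2] := qfactor_bound (normr_ge0 (b * q / a)).
have [M3 M30 h3] :=
  qfactor_bound (mulr_ge0 (normr_ge0 (a * b * e * f * b)) D0).
have [M4 M40 h4] := qfactor_bound (mulr_ge0 (normr_ge0 b) D0).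
have [M5 M50 h5] := qfactor_bound (normr_ge0 (b * e)).
have [M6 M60 h6] := qfactor_bound (normr_ge0 (b * f)).
exists (`|b| * M1 * M2 * M3 * (M4 * M5 * M6)) => d dD; split => // [|i].
  by rewrite !mulr_ge0 // ltW.
apply: ler_normM; last by rewrite normrX.
do ?apply: ler_normM => //.
- by have [] := h1 q i (lexx _).
- by have [] := h2 _ i (lexx _).
- have [|//] := h3 (a * b * d * e * f * b) i.
  rewrite (_ : a * b * d * e * f * b = a * b * e * f * b * d); last by ring.
  exact: ler_normM.
- by have [|//] := h4 (b * d) i; exact: ler_normM.
- by have [] := h5 _ i (lexx _).
- by have [] := h6 _ i (lexx _).
Qed.

(* The telescoping function is abd (t/a, t/b, ct)/(dt, et, ft). *)
Lemma av_sum_step a b d e f : a != 0 ->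
  (1 - a * d) * av_sum a b d e f
  - (1 - a * b * d * e) * (1 - a * b * d * f) * av_sum a b (d * q) e f
  = - (a * b * d * (oo (b * d * q) * oo (b * e) * oo (b * f))).
Proof.
move=> a0.
have [M /(_ d (lexx _)) dM] := av_dominated a b e f (normr_ge0 d).
have [M' /(_ (d * q) (lexx _)) dM'] := av_dominated a b e f (normr_ge0 (d * q)).
rewrite -(sumooZ C_complete (1 - a * d) dM).
(* The value at t = b q^k, multiplied by (bdq, be, bf)_oo. The factor written with [1 * q ^+ k]
   comes from t/b and vanishes at k = 0, so the default value of [k.-1] there is harmless. *)
pose G k := - (a * b * d * (oo (1 * q ^+ k) * oo (b / a * q ^+ k)
  * oo (a * b * d * e * f * b * q ^+ k)
  * ((b * d * q) ^_ k.-1 * (b * e) ^_ k * (b * f) ^_ k))).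
have G0 : G 0%N = 0 by rewrite /G expr0 mulr1 qpochoo1 // !mul0r mulr0 oppr0.
rewrite -[RHS]subr0 -G0.
apply: (telescope_sumoo C_complete (dominatedZ _ dM) dM').
- move=> k; rewrite /av_term /G.
  set c := a * b * d * e * f * b.
  have Ec : a * b * (d * q) * e * f * b = c * q by rewrite /c; ring.
  have S x : oo (x * q ^+ k) = (1 - x * q ^+ k) * oo (x * q * q ^+ k).
    by rewrite (qpochooS C_complete q_lt1) mulrAC.
  have S' x : oo (x * q ^+ k.+1) = oo (x * q * q ^+ k) by rewrite exprS mulrA.
  rewrite Ec !S' (S 1) (S (b / a)) (S c) mul1r [b / a * q]mulrAC.
  rewrite [b * (d * q)]mulrA !(qpochS _ (b * e)) !(qpochS _ (b * f)).
  case: {S S'} k => [|k].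
    rewrite !qpoch0n /= expr0 !mulr1.
    move: (oo q) (oo (b * q / a)) (oo (c * q)) => u1 u2 u3.
    by rewrite /c; field.
  rewrite (qpochSl _ (b * d)) (qpochS _ (b * d * q)) /=.
  move: (oo (q * q ^+ k.+1)) (oo (b * q / a * q ^+ k.+1)) => u1 u2.
  move: (oo (c * q * q ^+ k.+1)) (_ ^_ k) => u3 u4.
  move: (_ ^_ k.+1) (_ ^_ k.+1) => u5 u6.
  by rewrite exprS /c; field.
- rewrite /G -cvg_shiftS /=.
  have E x : (fun k => oo (x * q ^+ k.+1)) @ \oo --> (1 : C).
    by rewrite (cvg_shiftS (fun k => oo (x * q ^+ k))); exact: qpochoo_cvg1.
  have F x : (fun k => x ^_ k.+1) @ \oo --> oo x.
    by rewrite (cvg_shiftS (fun k => x ^_ k)); exact: qpoch_cvg.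
  have H := cvgM (cvgM (cvgM (E 1) (E (b / a))) (E (a * b * d * e * f * b)))
    (cvgM (cvgM (@qpoch_cvg _ C_complete _ q_lt1 (b * d * q)) (F (b * e))) (F (b * f))).
  apply: cvgN; apply: cvgMl_tmp; have := H _ _ _ _ _; rewrite !mul1r; exact.
Qed.

(** The boundary terms of the two telescoping sums, each multiplied by the product attached to the
    other endpoint, both become -abd (adq, ae, af, bdq, be, bf)_oo and cancel. *)
Lemma av_diff_step a b d e f : a != 0 -> b != 0 ->
  av_diff a b d e f =
  (1 - a * b * d * e) * (1 - a * b * d * f) * av_diff a b (d * q) e f.
Proof.
move=> a0 b0; rewrite /av_diff.
have H1 := av_sum_step b d e f a0; have H2 := av_sum_step a d e f b0.
rewrite (qpochooS C_complete q_lt1 (a * d)) (qpochooS C_complete q_lt1 (b * d)).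
rewrite !mulrA; apply/eqP; rewrite -subr_eq0; apply/eqP.
transitivity (oo (a * d * q) * oo (a * e) * oo (a * f) *
    (- (a * b * d * (oo (b * d * q) * oo (b * e) * oo (b * f)))) -
  oo (b * d * q) * oo (b * e) * oo (b * f) *
    (- (b * a * d * (oo (a * d * q) * oo (a * e) * oo (a * f)))));
  last by ring.
by rewrite -H1 -H2; ring.
Qed.

Lemma av_termC12 a b d e f i : av_term a b d e f i = av_term a b e d f i.
Proof.
by rewrite /av_term; congr (_ * oo _ * _ * _); ring.
Qed.

Lemma av_termC13 a b d e f i : av_term a b d e f i = av_term a b f e d i.
Proof. by rewrite /av_term; congr (_ * oo _ * _ * _); ring. Qed.

Lemma av_diffC12 a b d e f : av_diff a b d e f = av_diff a b e d f.
Proof.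
rewrite /av_diff /av_sum (eq_sumoo (av_termC12 a b d e f)).
rewrite (eq_sumoo (av_termC12 b a d e f)).
by ring.
Qed.

Lemma av_diffC13 a b d e f : av_diff a b d e f = av_diff a b f e d.
Proof.
rewrite /av_diff /av_sum (eq_sumoo (av_termC13 a b d e f)).
rewrite (eq_sumoo (av_termC13 b a d e f)).
by ring.
Qed.

Lemma av_diff_iter a b d e f N : a != 0 -> b != 0 ->
  av_diff a b d e f =
  (a * b * d * e) ^_ N * (a * b * d * f) ^_ N * av_diff a b (d * q ^+ N) e f.
Proof.
move=> a0 b0; elim: N => [|N IH]; first by rewrite !qpoch0n expr0 !mul1r mulr1.
rewrite {}IH av_diff_step // !qpochS exprSr !mulrA.
rewrite (_ : a * b * d * q ^+ N * e = a * b * d * e * q ^+ N); last by ring.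
rewrite (_ : a * b * d * q ^+ N * f = a * b * d * f * q ^+ N); last by ring.
by ring.
Qed.

Lemma av_sum_limit a b d e f :
  (fun N => av_sum a b (d * q ^+ N) e f) @ \oo --> av_sum a b 0 e f.
Proof.
have [M dM] := av_dominated a b e f (normr_ge0 d).
apply: (tannery C_complete (fun N => dM _ (normr_exprn_le d N))) => i.
rewrite /av_term.
have h1 : (fun N => oo (a * b * (d * q ^+ N) * e * f * b * q ^+ i)) @ \oo -->
    oo (a * b * 0 * e * f * b * q ^+ i).
  rewrite !(mulr0, mul0r) qpochoo0 //.
  have E N : a * b * (d * q ^+ N) * e * f * b * q ^+ i =
    a * b * d * e * f * b * q ^+ i * q ^+ N by ring.
  by under eq_fun do rewrite E; exact: qpochoo_cvg1.
have h2 : (fun N => (b * (d * q ^+ N)) ^_ i) @ \oo --> (b * 0) ^_ i.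
  rewrite mulr0 qpoch0.
  by under eq_fun do rewrite mulrA; exact: qpoch_cvg1.
apply: cvgMr_tmp; apply: cvgM; first exact: cvgMl_tmp.
by do 2!apply: cvgMr_tmp.
Qed.

Lemma av_diff_limit a b d e f :
  (fun N => av_diff a b (d * q ^+ N) e f) @ \oo --> av_diff a b 0 e f.
Proof.
have h x : (fun N => oo (x * (d * q ^+ N))) @ \oo --> oo (x * 0).
  rewrite mulr0 qpochoo0 //.
  by under eq_fun do rewrite mulrA; exact: qpochoo_cvg1.
by apply: cvgB; apply: cvgM; try exact: av_sum_limit; do 2!apply: cvgMr_tmp.
Qed.

Lemma av_diff_shift a b d e f : a != 0 -> b != 0 ->
  av_diff a b d e f =
  oo (a * b * d * e) * oo (a * b * d * f) * av_diff a b 0 e f.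
Proof.
move=> a0 b0.
apply: (@cvgn_unique _ (fun=> av_diff a b d e f)); first exact: cvg_cst.
rewrite (funext (fun N => av_diff_iter d e f N a0 b0)).
apply: cvgM; last exact: av_diff_limit.
by apply: cvgM; exact: qpoch_cvg.
Qed.

(** By symmetry in d, e, f the three parameters are sent to 0 in turn; once d is 0, only the factor
    with abef is still produced. *)
Lemma av_diff_reduce a b d e f : a != 0 -> b != 0 ->
  av_diff a b d e f = oo (a * b * d * e) * oo (a * b * d * f)
    * oo (a * b * e * f) * av_diff a b 0 0 0.
Proof.
move=> a0 b0; rewrite av_diff_shift // -[RHS]mulrA; congr (_ * _).
rewrite av_diffC12 av_diff_shift // mulr0 qpochoo0 // mul1r.
congr (_ * _); rewrite av_diffC13 av_diff_shift //.
by rewrite !mulr0 qpochoo0 // !mul1r.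
Qed.

(* For e = q/a and f = q/b the integrand is constant on the points [b q^i]. *)
Lemma av_sum_base a b : a != 0 -> b != 0 ->
  av_sum a b 0 (q / a) (q / b) = b * oo q * oo (b * q / a) / (1 - q).
Proof.
move=> a0 b0; rewrite /av_sum.
rewrite (@eq_sumoo _ _ (fun i => b * oo q * oo (b * q / a) * q ^+ i)); last first.
  move=> i; rewrite /av_term !(mulr0, mul0r) qpochoo0 // qpoch0 mulr1 mul1r.
  rewrite [b * (q / b)]mulrC divfK // [b * (q / a)]mulrA.
  rewrite (qpochoo_split C_complete q_lt1 q i).
  by rewrite (qpochoo_split C_complete q_lt1 (b * q / a) i); ring.
have d : dominated 1 `|q| (fun i => q ^+ i : C).
  by split => // i; rewrite mul1r normrX.
rewrite (sumooZ C_complete _ d); congr (_ * _).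
have q10 : 1 - q != 0.
  by rewrite subr_eq0; apply: contraTneq q_lt1 => <-; rewrite normr1 ltxx.
apply: (cvgn_unique (dominated_lim C_complete d)).
have E n : \sum_(0 <= k < n) q ^+ k = (1 - q ^+ n) / (1 - q).
  apply: (mulIf q10); rewrite divfK // big_mkord.
  by rewrite mulrC -[1 - q]opprB mulNr -subrX1 opprB.
under eq_fun do rewrite E.
suff : (fun n => (1 - q ^+ n) / (1 - q)) @ \oo --> (1 - 0) / (1 - q).
  by rewrite subr0 mul1r.
apply: cvgMr_tmp; apply: cvgB; first exact: cvg_cst.
exact: cvg_exprn0.
Qed.

(** The constant depends on a and b only, so one explicit instance determines it: d = 0, e = q/a, f
    = q/b, where both sums are geometric. There abef = q^2, and (q^2;q)_oo can be cancelled since it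
    is nonzero. *)
Lemma av_diff0 a b : a != 0 -> b != 0 ->
  av_diff a b 0 0 0 = b * oo q * oo (b * q / a) * oo (a / b).
Proof.
move=> a0 b0.
have q10 : 1 - q != 0.
  by rewrite subr_eq0; apply: contraTneq q_lt1 => <-; rewrite normr1 ltxx.
have n0 : oo (q * q) != 0.
  apply: qpochoo_neq0 => //; rewrite normrM.
  by rewrite (le_lt_trans _ q_lt1) // ler_piMr // ltW.
apply: (mulfI n0).
have := av_diff_reduce 0 (q / a) (q / b) a0 b0.
rewrite !(mulr0, mul0r) qpochoo0 // !mul1r.
have -> : a * b * (q / a) * (q / b) = q * q by field; rewrite ?a0 ?b0.
move=> <-; rewrite /av_diff av_sum_base //.
have -> : av_sum b a 0 (q / a) (q / b) = a * oo q * oo (a * q / b) / (1 - q).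
  rewrite -av_sum_base // /av_sum; apply: eq_sumoo => i.
  by rewrite /av_term; congr (_ * oo _ * _ * _); ring.
rewrite !mulr0 qpochoo0 // !mul1r.
have -> : a * (q / a) = q by rewrite mulrC divfK.
have -> : b * (q / b) = q by rewrite mulrC divfK.
rewrite (qpochooS C_complete q_lt1 (a / b)) (qpochooS C_complete q_lt1 q).
have -> : a * (q / b) = a * q / b by rewrite mulrA.
have -> : b * (q / a) = b * q / a by rewrite mulrA.
have -> : a / b * q = a * q / b by rewrite mulrAC.
move: (oo (q * q)) (oo (a * q / b)) (oo (b * q / a)) => u1 u2 u3.
by field; rewrite ?a0 ?b0.
Qed.

Theorem av_diffE a b d e f : a != 0 -> b != 0 ->
  av_diff a b d e f = b * oo q * oo (b * q / a) * oo (a / b)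
    * (oo (a * b * d * e) * oo (a * b * d * f) * oo (a * b * e * f)).
Proof. by move=> a0 b0; rewrite av_diff_reduce // av_diff0 // mulrC. Qed.

End AlSalamVerma.

(** * The nonterminating 6phi5 sum *)

Section SixPhiFive.
Local Open Scope classical_set_scope.
Variable C : numFieldType.
Hypothesis C_complete : geo_complete C.
Variable q : C.
Hypothesis q_neq0 : q != 0.
Hypothesis q_lt1 : `|q| < 1.
Implicit Types (x y z al b c d : C) (n k : nat).

Local Notation "x ^_ n" := (qpoch x q n).
Local Notation oo x := (qpochoo x q).

(** The index type is arbitrary so that bounds uniform in one index or in a pair of indices come
    from the same closure lemmas. *)
Definition ubounded (T : Type) (f : T -> C) :=
  exists2 M : C, 0 < M & forall t, `|f t| <= M.

Lemma ubounded_cst T x : ubounded (fun _ : T => x).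
Proof.
exists (`|x| + 1) => [|_]; first by rewrite ltr_wpDl.
by rewrite lerDl.
Qed.

Lemma ubounded_le T (f : T -> C) (M : C) : (forall t, `|f t| <= M) -> ubounded f.
Proof.
move=> fM; exists (`|M| + 1) => [|t]; first by rewrite ltr_wpDl.
apply: le_trans (fM t) _; have M0 := le_trans (normr_ge0 _) (fM t).
by rewrite ger0_norm // lerDl.
Qed.

Lemma uboundedM T (f g : T -> C) :
  ubounded f -> ubounded g -> ubounded (fun t => f t * g t).
Proof.
move=> [M M0 fM] [M' M0' gM]; exists (M * M') => [|t]; first exact: mulr_gt0.
by rewrite normrM ler_pM.
Qed.

Lemma uboundedB T (f g : T -> C) :
  ubounded f -> ubounded g -> ubounded (fun t => f t - g t).
Proof.
move=> [M M0 fM] [M' M0' gM]; exists (M + M') => [|t]; first exact: addr_gt0.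
by apply: le_trans (ler_normB _ _) _; rewrite lerD.
Qed.

Lemma ubounded_exprn T (n : T -> nat) : ubounded (fun t => q ^+ n t).
Proof.
exists 1 => // t; rewrite normrX exprn_ile1 // ltW //.
Qed.

Lemma ubounded_qpoch T (f : T -> C) (n : T -> nat) :
  ubounded f -> ubounded (fun t => f t ^_ n t).
Proof.
move=> [M M0 fM]; have [M' M0' h] := qpoch_bound C_complete q_lt1 (ltW M0).
by exists M' => // t; exact: h.
Qed.

Lemma ubounded_qpochoo T (f : T -> C) :
  ubounded f -> ubounded (fun t => oo (f t)).
Proof.
move=> [M M0 fM]; have [M' M0' h] := qpochoo_bound C_complete q_lt1 (ltW M0).
by exists M' => // t; exact: h.
Qed.

Lemma qpochq_neq0 n : q ^_ n != 0.
Proof.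
have : oo q != 0 by exact: qpochoo_neq0.
by rewrite (qpochoo_split C_complete q_lt1 q n) mulf_eq0 negb_or => /andP[].
Qed.

(** 1/(q;q)_m is (q^(m+1);q)_oo / (q;q)_oo, a bounded numerator over a constant. *)
Lemma ubounded_invq T (n : T -> nat) : ubounded (fun t => (q ^_ n t)^-1).
Proof.
have oq0 : oo q != 0 by exact: qpochoo_neq0.
have E m : (q ^_ m)^-1 = oo (q * q ^+ m) / oo q.
  rewrite (qpochoo_split C_complete q_lt1 q m) invfM mulrCA divff ?mulr1 //.
  move: oq0; rewrite (qpochoo_split C_complete q_lt1 q m) mulf_eq0 negb_or.
  by case/andP.
rewrite (funext (fun t => E (n t))).
apply: uboundedM; last exact: ubounded_cst.
apply: ubounded_qpochoo; apply: uboundedM; first exact: ubounded_cst.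
exact: ubounded_exprn.
Qed.

Lemma ubounded_dominated (f : nat -> C) z : ubounded f -> `|z| < 1 ->
  exists M, dominated M `|z| (fun k => f k * z ^+ k).
Proof.
move=> [M M0 fM] z1; exists M; split => // [|k]; first exact: ltW.
by rewrite normrM normrX ler_wpM2r ?exprn_ge0.
Qed.

Lemma dominated_cvg0 M r (f : nat -> C) : dominated M r f ->
  f @ \oo --> (0 : C).
Proof. by move=> /C_complete; exact: cvg_series_cvg_0. Qed.

Lemma sumoo_finite n (f : nat -> C) : (forall k, (n <= k)%N -> f k = 0) ->
  sumoo f = \sum_(0 <= k < n) f k.
Proof.
move=> f0; apply: cvg_eq_limn; apply: cvg_near_cst.
near=> m; rewrite (big_cat_nat (n := n)) //=; last by near: m; exact: nbhs_infty_ge.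
rewrite [X in _ + X]big_nat_cond [X in _ + X]big1 ?addr0 // => i.
by rewrite andbT => /andP[/f0].
Unshelve. all: by end_near. Qed.

(* [(al)_k (1 - al q^(2k)) / (1 - al)], with the division carried out. *)
Definition vwp al k : C :=
  if k is k'.+1 then (al * q) ^_ k' * (1 - al * q ^+ k ^+ 2) else 1.

Lemma vwpE al k : al ^_ k * (1 - al * q ^+ k ^+ 2) = (1 - al) * vwp al k.
Proof.
case: k => [|k]; first by rewrite qpoch0n expr0 expr1n mul1r !mulr1.
by rewrite qpochSl -mulrA.
Qed.

Lemma ubounded_vwp T (f : T -> C) (n : T -> nat) :
  ubounded f -> ubounded (fun t => vwp (f t) (n t)).
Proof.
move=> bf; have [M M0 hM] : ubounded (fun t =>
    (f t * q) ^_ (n t).-1 * (1 - f t * (q ^+ n t * q ^+ n t))).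
  apply: uboundedM.
    by apply: ubounded_qpoch; apply: uboundedM => //; exact: ubounded_cst.
  apply: uboundedB; first exact: ubounded_cst.
  by apply: uboundedM => //; apply: uboundedM; exact: ubounded_exprn.
exists (M + 1) => [|t]; first exact: addr_gt0.
case: (n t) (hM t) => [|k] /= h; first by rewrite normr1 lerDr ltW.
by apply: le_trans h _; rewrite lerDl.
Qed.

(* The 6phi5 term with its denominators multiplied out to infinite products. *)
Definition phi65_coef al b c d k : C :=
  vwp al k * (b ^_ k * c ^_ k * d ^_ k / q ^_ k)
  * (oo (al * q / b * q ^+ k) * oo (al * q / c * q ^+ k)
     * oo (al * q / d * q ^+ k)).

Definition phi65_term al b c d k : C :=
  phi65_coef al b c d k * (al * q / (b * c * d)) ^+ k.

Lemma ubounded_phi65_coef T (al : T -> C) b c d (n : T -> nat) :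
  ubounded al -> ubounded (fun t => phi65_coef (al t) b c d (n t)).
Proof.
move=> bal.
have h x : ubounded (fun t => oo (al t * q / x * q ^+ n t)).
  apply: ubounded_qpochoo; apply: uboundedM; last exact: ubounded_exprn.
  by do 2![apply: uboundedM; last exact: ubounded_cst].
apply: uboundedM; last by do 2?apply: uboundedM.
apply: uboundedM; first exact: ubounded_vwp.
apply: uboundedM; last exact: ubounded_invq.
by do 2?apply: uboundedM; apply: ubounded_qpoch; exact: ubounded_cst.
Qed.

Lemma phi65_dominated al b c d : `|al * q / (b * c * d)| < 1 ->
  exists M, dominated M `|al * q / (b * c * d)| (phi65_term al b c d).
Proof.
move=> z1; apply: ubounded_dominated => //.
by apply: (@ubounded_phi65_coef _ (fun=> al)); exact: ubounded_cst.
Qed.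

(** The argument of the series is z q^N and tends to 0, so only the term k = 0 survives, and it is a
    product of three infinite products that tend to 1. *)
Lemma phi65_limit al b c d : `|al * q / (b * c * d)| < 1 ->
  (fun N => sumoo (phi65_term (al * q ^+ N) b c d)) @ \oo --> (1 : C).
Proof.
move=> z1.
have [M M0 hM] : ubounded (fun Nk : nat * nat =>
    phi65_coef (al * q ^+ Nk.1) b c d Nk.2).
  apply: ubounded_phi65_coef; apply: uboundedM; first exact: ubounded_cst.
  exact: ubounded_exprn.
set z := al * q / (b * c * d) in z1.
have Ez N : al * q ^+ N * q / (b * c * d) = z * q ^+ N by rewrite /z; ring.
have dF N : dominated M `|z| (phi65_term (al * q ^+ N) b c d).
  split => // [|k]; first exact: ltW.
  rewrite /phi65_term Ez; apply: ler_normM; first exact: (hM (N, k)).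
  by rewrite normrX lerXn2r ?nnegrE // normr_exprn_le.
have <- : sumoo (fun k => (k == 0%N)%:R) = (1 : C).
  rewrite (@sumoo_finite 1) ?big_nat1 // => k.
  by case: k.
apply: (tannery C_complete dF) => k; rewrite /phi65_term.
case: k => [|k].
  have E0 N : phi65_coef (al * q ^+ N) b c d 0 * (al * q ^+ N * q / (b * c * d)) ^+ 0
      = oo (al * q ^+ N * q / b) * oo (al * q ^+ N * q / c)
        * oo (al * q ^+ N * q / d).
    by rewrite /phi65_coef /= !qpoch0n !expr0 !mulr1 invr1; ring.
  under eq_fun do rewrite E0.
  have h x : (fun N => oo (al * q ^+ N * q / x)) @ \oo --> (1 : C).
    have E N : al * q ^+ N * q / x = al * q / x * q ^+ N by ring.
    by under eq_fun do rewrite E; exact: qpochoo_cvg1.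
  by have := cvgM (cvgM (h b) (h c)) (h d); rewrite !mulr1; exact.
apply/cvgrPdist_lt => e e0.
have /cvgrPdist_lt/(_ _ (divr_gt0 e0 M0)) nr : (fun n => q ^+ n) @ \oo --> (0 : C).
  exact: cvg_exprn0.
near=> N.
rewrite sub0r normrN.
have : `|0 - q ^+ N| < e / M by near: N.
rewrite sub0r normrN ltr_pdivlMr // => h.
apply: le_lt_trans h; rewrite [leRHS]mulrC.
apply: ler_normM; first exact: (hM (N, k.+1)).
rewrite Ez exprS normrM -[leRHS]mulr1; apply: ler_pM => //.
  by rewrite normrM ler_piMl // ltW.
rewrite normrX exprn_ile1 //.
by apply: le_trans (normr_exprn_le q_lt1 _ _) _; exact: ltW.
Unshelve. all: by end_near. Qed.

(** The difference of the two sides telescopes, with a boundary function that vanishes at 0 and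
    tends to 0 at infinity. *)
Lemma phi65_step al b c d : b != 0 -> c != 0 -> d != 0 ->
  `|al * q / (b * c * d)| < 1 ->
  (1 - al * q / (b * c * d)) * sumoo (phi65_term al b c d) =
  (1 - al * q) * (1 - al * q / (b * c)) * (1 - al * q / (b * d))
    * (1 - al * q / (c * d)) * sumoo (phi65_term (al * q) b c d).
Proof.
move=> b0 c0 d0 z1; set z := al * q / (b * c * d) in z1 *.
have Ez : al * q * q / (b * c * d) = z * q by rewrite /z; ring.
have z1' : `|z * q| < 1.
  by apply: le_lt_trans z1; rewrite normrM ler_piMr // ltW.
have [M dM] := phi65_dominated z1.
have [|M' dM'] := @phi65_dominated (al * q) b c d; first by rewrite Ez.
pose H k := (al * z * q ^+ k.+1 - 1) * (al * q) ^_ k *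
  (b ^_ k.+1 * c ^_ k.+1 * d ^_ k.+1 / q ^_ k)
  * (oo (al * q / b * q ^+ k.+1) * oo (al * q / c * q ^+ k.+1)
     * oo (al * q / d * q ^+ k.+1)) * z.
(* [G k] carries 1/(q;q)_(k-1), which is read as 0 at k = 0. *)
pose G k := if k is k'.+1 then H k' * z ^+ k' else 0.
have bH : ubounded H.
  have h x : ubounded (fun k => oo (al * q / x * q ^+ k.+1)).
    apply: ubounded_qpochoo; apply: uboundedM; first exact: ubounded_cst.
    exact: ubounded_exprn.
  apply: uboundedM; last exact: ubounded_cst.
  apply: uboundedM; last by do 2?apply: uboundedM.
  apply: uboundedM; first apply: uboundedM.
  - apply: uboundedB; last exact: ubounded_cst.
    by apply: uboundedM; [exact: ubounded_cst|exact: ubounded_exprn].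
  - by apply: ubounded_qpoch; exact: ubounded_cst.
  - apply: uboundedM; last exact: ubounded_invq.
    by do 2?apply: uboundedM; apply: ubounded_qpoch; exact: ubounded_cst.
have [MH dH] := ubounded_dominated bH z1.
have G0 : G @ \oo --> (0 : C).
  by rewrite -cvg_shiftS; exact: (dominated_cvg0 dH).
rewrite -(sumooZ C_complete _ dM); apply/eqP; rewrite -subr_eq0; apply/eqP.
rewrite (telescope_sumoo C_complete (dominatedZ _ dM) dM' _ G0) ?subrr // => k.
rewrite /phi65_term /phi65_coef -/z Ez.
have S x : oo (al * q / x * q ^+ k) =
    (1 - al * q / x * q ^+ k) * oo (al * q * q / x * q ^+ k).
  rewrite (qpochooS C_complete q_lt1); congr (_ * oo _); ring.
have S' x : oo (al * q / x * q ^+ k.+1) = oo (al * q * q / x * q ^+ k).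
  by congr (oo _); rewrite exprS; ring.
move: (S b) (S c) (S d) (S' b) (S' c) (S' d).
move: (oo (al * q * q / b * q ^+ k)) (oo (al * q * q / c * q ^+ k)) => u1 u2.
move: (oo (al * q * q / d * q ^+ k)) => u3.
case: k {S S'} => [|k] T1 T2 T3 S1 S2 S3.
  rewrite T1 T2 T3 /G /H S1 S2 S3 !qpochS !qpoch0n /vwp !expr0 expr1 /z.
  by field; rewrite b0 c0 d0.
rewrite /G /H S1 S2 S3 T1 T2 T3 /vwp.
(* Relates the shifted factor to the unshifted one without dividing by 1 - al q, which may
   vanish. *)
have E : (1 - al * q) * (al * q * q) ^_ k = (al * q) ^_ k * (1 - al * q * q ^+ k).
  by rewrite -qpochSl qpochS.
have := qpochq_neq0 k.+1; rewrite (qpochS _ q) mulf_eq0 negb_or => /andP[q1 q2].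
rewrite (qpochS _ (al * q)) (qpochS _ b k.+1) (qpochS _ c k.+1).
rewrite (qpochS _ d k.+1).
move: E q1 q2; rewrite (exprMn k.+1 z q).
move: (b ^_ _) (c ^_ _) (d ^_ _) => vb vc vd.
move: ((al * q) ^_ k) ((al * q * q) ^_ k) (q ^_ k) => w1 w2 w3 E q1 q2.
rewrite [X in _ - X](_ : _ = ((1 - al * q) * w2) *
  ((1 - al * q / (b * c)) * (1 - al * q / (b * d)) * (1 - al * q / (c * d))
   * (1 - al * q * (q ^+ k.+1) ^+ 2) * (vb * vc * vd / (w3 * (1 - q * q ^+ k)))
   * (u1 * u2 * u3) * (z ^+ k.+1 * q ^+ k.+1))); last by ring.
rewrite {}E !(exprS q) (exprS z k); move: (z ^+ k) => zk; rewrite /z.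
by field; rewrite b0 c0 d0 q1 q2.
Qed.

Lemma phi65_iter al b c d N : b != 0 -> c != 0 -> d != 0 ->
  `|al * q / (b * c * d)| < 1 ->
  (al * q / (b * c * d)) ^_ N * sumoo (phi65_term al b c d) =
  (al * q) ^_ N * (al * q / (b * c)) ^_ N * (al * q / (b * d)) ^_ N
    * (al * q / (c * d)) ^_ N * sumoo (phi65_term (al * q ^+ N) b c d).
Proof.
move=> b0 c0 d0 z1; elim: N => [|N IH].
  by rewrite !qpoch0n expr0 !mul1r mulr1.
have E x : al * q ^+ N * q / x = al * q / x * q ^+ N by ring.
have := @phi65_step (al * q ^+ N) b c d b0 c0 d0; rewrite !E => step.
rewrite !qpochS mulrAC {}IH.
transitivity ((al * q) ^_ N * (al * q / (b * c)) ^_ N * (al * q / (b * d)) ^_ N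
    * (al * q / (c * d)) ^_ N * ((1 - al * q / (b * c * d) * q ^+ N) *
    sumoo (phi65_term (al * q ^+ N) b c d))); first by ring.
rewrite step; last exact: le_lt_trans (normr_exprn_le q_lt1 _ _) z1.
rewrite (_ : al * q ^+ N * q = al * q ^+ N.+1); last by rewrite exprS; ring.
by rewrite exprS; ring.
Qed.

Theorem phi65_sum al b c d : b != 0 -> c != 0 -> d != 0 ->
  `|al * q / (b * c * d)| < 1 ->
  oo (al * q / (b * c * d)) * sumoo (phi65_term al b c d) =
  oo (al * q) * oo (al * q / (b * c)) * oo (al * q / (b * d))
    * oo (al * q / (c * d)).
Proof.
move=> b0 c0 d0 z1.
have h1 : (fun N => (al * q / (b * c * d)) ^_ N * sumoo (phi65_term al b c d))
    @ \oo --> oo (al * q / (b * c * d)) * sumoo (phi65_term al b c d).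
  by apply: cvgMr_tmp; exact: qpoch_cvg.
apply: (cvgn_unique h1); rewrite (funext (fun N => phi65_iter N b0 c0 d0 z1)).
rewrite -[X in _ @ _ --> X]mulr1; apply: cvgM; last exact: phi65_limit.
by do 3?apply: cvgM; exact: qpoch_cvg.
Qed.

(** Shifting al and d together leaves the argument al q/(bcd) unchanged. The remainder contains
    (dq;q)_n, which is 0 when dq = q^(-i) with i < n: this is the recurrence for terminating sums,
    free of any condition on the argument. *)
Lemma phi65_finite_step al b c d n : b != 0 -> c != 0 -> d != 0 ->
  \sum_(0 <= k < n.+1) phi65_term al b c d k
  - (1 - al * q) * (1 - al * q / (b * c))
    * \sum_(0 <= k < n.+1) phi65_term (al * q) b c (d * q) k
  = d * (al * q) ^_ n * (b ^_ n.+1 * c ^_ n.+1 * (d * q) ^_ n / q ^_ n)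
    * (oo (al * q / b * q ^+ n.+1) * oo (al * q / c * q ^+ n.+1)
     * oo (al * q / d * q ^+ n)) * (al * q / (b * c * d)) ^+ n.+1.
Proof.
move=> b0 c0 d0.
set z := al * q / (b * c * d).
have Ez : al * q * q / (b * c * (d * q)) = z by rewrite /z; field; rewrite q_neq0 b0 c0 d0.
have S1 x k : oo (al * q / x * q ^+ k) =
    (1 - al * q / x * q ^+ k) * oo (al * q * q / x * q ^+ k).
  rewrite (qpochooS C_complete q_lt1); congr (_ * oo _); ring.
have S2 x k : oo (al * q / x * q ^+ k.+1) = oo (al * q * q / x * q ^+ k).
  by congr (oo _); rewrite exprS; ring.
have S3 k : oo (al * q * q / (d * q) * q ^+ k) = oo (al * q / d * q ^+ k).
  by congr (oo _); field; rewrite q_neq0 d0.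
elim: n => [|n IH].
  rewrite !big_nat1 /phi65_term /phi65_coef -/z Ez !S2 S3 (S1 b) (S1 c).
  move: (oo _) (oo _) (oo _) => u1 u2 u3.
  rewrite !qpochS !qpoch0n /vwp !expr0 expr1 /z.
  by field; rewrite b0 c0 d0.
rewrite !(@big_nat_recr _ _ _ n.+1) //= mulrDr opprD addrACA {}IH.
have S4 : oo (al * q / d * q ^+ n) =
    (1 - al * q / d * q ^+ n) * oo (al * q / d * q ^+ n.+1).
  by rewrite (qpochooS C_complete q_lt1) exprSr mulrA.
rewrite /phi65_term /phi65_coef -/z Ez S3 S4 !(S2 _ n.+1).
rewrite (S1 b n.+1) (S1 c n.+1).
move: (oo _) (oo _) (oo _) => u1 u2 u3.
have E : (1 - al * q) * (al * q * q) ^_ n = (al * q) ^_ n * (1 - al * q * q ^+ n).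
  by rewrite -qpochSl qpochS.
have := qpochq_neq0 n.+1; rewrite (qpochS _ q) mulf_eq0 negb_or => /andP[q1 q2].
rewrite /vwp (qpochS _ (al * q)) (qpochS _ b n.+1) (qpochS _ c n.+1).
rewrite (qpochSl _ d) (qpochS _ (d * q)).
move: E q1 q2; rewrite !(exprS z).
move: (b ^_ _) (c ^_ _) ((d * q) ^_ _) => vb vc vd.
move: ((al * q) ^_ n) ((al * q * q) ^_ n) (q ^_ n) => w1 w2 w3 E q1 q2.
rewrite [X in _ + (_ - X)](_ : _ = ((1 - al * q) * w2) *
  ((1 - al * q / (b * c)) * (1 - al * q * (q ^+ n.+1) ^+ 2)
   * (vb * vc * (vd * (1 - d * q * q ^+ n)) / (w3 * (1 - q * q ^+ n)))
   * (u1 * u2 * u3) * (z * z ^+ n))); last by ring.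
rewrite {}E !(exprS q); move: (z ^+ n) => zk; rewrite /z.
by field; rewrite b0 c0 d0 q1 q2.
Qed.

Lemma qpoch_root n k : (k < n)%N -> (q ^- k) ^_ n = 0.
Proof.
move=> kn; rewrite /qpoch (bigD1_seq k) ?iota_uniq ?mem_index_iota //=.
by rewrite mulVf ?expf_neq0 // subrr mul0r.
Qed.

(** Serves the points t = b q^i, where b/t = q^(-i). The induction lowers i through the shift of d;
    at i = 0 only the term k = 0 is nonzero. *)
Lemma phi65_finite_sum al b c i n : b != 0 -> c != 0 -> (i < n)%N ->
  \sum_(0 <= k < n) phi65_term al b c (q ^- i) k =
  oo (al * q) * (al * q / (b * c)) ^_ i
    * (oo (al * q / b * q ^+ i) * oo (al * q / c * q ^+ i)).
Proof.
move=> b0 c0; elim: i al n => [|i IH] al [//|n] ilt.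
  rewrite big_nat_recl // big1 => [|k _].
    rewrite /phi65_term /phi65_coef /= !qpoch0n !expr0 invr1 !divr1 !mulr1.
    by rewrite addr0; ring.
  rewrite /phi65_term /phi65_coef expr0 invr1 (qpochSl _ 1) subrr.
  by rewrite !(mul0r, mulr0).
have qi0 : q ^- i.+1 != 0 by rewrite invr_eq0 expf_neq0.
have qq : q ^- i.+1 * q = q ^- i by rewrite exprSr invfM -mulrA mulVf ?mulr1.
have := phi65_finite_step al n b0 c0 qi0; rewrite qq qpoch_root //.
rewrite !(mul0r, mulr0) => /eqP; rewrite subr_eq0 => /eqP ->.
rewrite {}IH; last exact: ltnW.
rewrite (qpochooS C_complete q_lt1 (al * q)) (qpochSl _ (al * q / (b * c))).
have E x : al * q * q / x = al * q / x * q by ring.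
by rewrite !E exprS !mulrA; ring.
Qed.

End SixPhiFive.

(** * Two-point q-integrals as very-well-poised series *)

Section TwoPointIntegral.
Local Open Scope classical_set_scope.
Variable C : numFieldType.
Hypothesis C_complete : geo_complete C.
Variable q : C.
Hypothesis q_neq0 : q != 0.
Hypothesis q_lt1 : `|q| < 1.
Implicit Types (x y z t a b c d e f g h : C) (n k i : nat).

Local Notation "x ^_ n" := (qpoch x q n).
Local Notation oo x := (qpochoo x q).

(** The function (b/t;q)_k t^k as a polynomial in t. *)
Definition qfall t b k : C := \prod_(0 <= m < k) (t - b * q ^+ m).

Lemma qfallE t b k : t != 0 -> (b / t) ^_ k * t ^+ k = qfall t b k.
Proof.
move=> t0; elim: k => [|k IH]; first by rewrite qpoch0n expr0 mulr1 /qfall big_nil.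
rewrite qpochS exprS /qfall big_nat_recr //= -/(qfall t b k) -IH.
by field.
Qed.

Lemma qfall_root b i k : (i < k)%N -> qfall (b * q ^+ i) b k = 0.
Proof.
move=> ik; rewrite /qfall (bigD1_seq i) ?iota_uniq ?mem_index_iota //=.
by rewrite subrr mul0r.
Qed.

(** The number (-b)^k q^(k(k-1)/2). *)
Definition qsign b k : C := \prod_(0 <= m < k) - (b * q ^+ m).

(** This is how the expansion functions move an endpoint: multiplied by (b/t;q)_k t^k, the factor
    (qt/b)_oo of the integrand becomes the one for the endpoint b q^k. *)
Lemma qfall_qpochoo t b k : b != 0 ->
  oo (t * q / b) * qfall t b k = qsign b k * oo (t * q / (b * q ^+ k)).
Proof.
move=> b0; elim: k => [|k IH].
  by rewrite /qfall /qsign !big_nil expr0 !mulr1 mul1r.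
rewrite /qfall /qsign !big_nat_recr //= -/(qfall t b k) -/(qsign b k).
have qk : q ^+ k != 0 by rewrite expf_neq0.
rewrite mulrA IH (qpochooS C_complete q_lt1 (t * q / (b * q ^+ k.+1))).
have -> : t * q / (b * q ^+ k.+1) * q = t * q / (b * q ^+ k).
  by rewrite exprS; field; rewrite b0 qk q_neq0.
by rewrite exprS; field; rewrite b0 qk q_neq0.
Qed.

(** Quasi-periodicity of the theta function (bq/a, a/b)_oo under b -> b q^k. The power a^k that it
    releases combines with h^k into the argument ah of the final series. *)
Lemma qsign_theta a b k : a != 0 -> b != 0 ->
  qsign b k * (q ^+ k * oo (b * q ^+ k * q / a) * oo (a / (b * q ^+ k))) =
  a ^+ k * (oo (b * q / a) * oo (a / b)).
Proof.
move=> a0 b0; elim: k => [|k IH].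
  by rewrite /qsign big_nil !expr0 !mulr1 !mul1r.
have qk : q ^+ k != 0 by rewrite expf_neq0.
rewrite (exprS a) -[RHS]mulrA -IH /qsign big_nat_recr //= -/(qsign b k).
rewrite (qpochooS C_complete q_lt1 (a / (b * q ^+ k.+1))).
rewrite (qpochooS C_complete q_lt1 (b * q ^+ k * q / a)).
have -> : a / (b * q ^+ k.+1) * q = a / (b * q ^+ k).
  by rewrite exprS; field; rewrite b0 qk q_neq0.
have -> : b * q ^+ k * q / a * q = b * q ^+ k.+1 * q / a by rewrite exprS; ring.
by rewrite exprS; field; rewrite b0 a0 qk q_neq0.
Qed.

(** Each factor a q^i - b q^m is at most |a| (1 + |b/a| |q|^m), uniformly in i. *)
Lemma qfall_bound_outer a b : a != 0 -> exists2 M : C, 0 < M &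
  forall i k, `|qfall (a * q ^+ i) b k| <= M * `|a| ^+ k.
Proof.
move=> a0; have [M M0 hM] := prod_bound C_complete
  (divr_ge0 (normr_ge0 b) (normr_ge0 a)) (normr_ge0 q) q_lt1.
exists M => // i k; apply: le_trans (_ : (\prod_(0 <= m < k)
    (1 + `|b| / `|a| * `|q| ^+ m)) * `|a| ^+ k <= _); last first.
  by rewrite ler_wpM2r ?exprn_ge0.
have -> : `|a| ^+ k = \prod_(0 <= m < k) `|a|.
  by rewrite prodr_const_nat subn0.
rewrite -big_split /qfall normr_prod /=; apply: ler_prod => m _.
rewrite normr_ge0 /=; apply: le_trans (ler_normB _ _) _.
have na0 : `|a| != 0 by rewrite normr_eq0.
rewrite mulrDl mul1r [_ / _ * _ * _]mulrAC divfK //.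
by apply: lerD; [exact: normr_exprn_le|rewrite normrM normrX].
Qed.

(** The decay in k must not depend on |bh|. For k > i the product is 0; otherwise its factors hb(q^i
    - q^m), with m < k and k at most i, are themselves of order |q|^m. *)
Lemma qfall_bound_inner b h : exists2 M : C, 0 < M &
  forall i k, `|h ^+ k * qfall (b * q ^+ i) b k| <= M * `|q| ^+ k.
Proof.
have nq0 : `|q| != 0 by rewrite normr_eq0.
(* With this constant X, the bound 2 |hb| |q|^m on a factor is at most |q| (1 + X |q|^m), which
   leaves a bounded product times |q|^k. *)
have X0 : 0 <= 2 * `|h * b| / `|q| by rewrite divr_ge0 ?mulr_ge0.
have [M M0 hM] := prod_bound C_complete X0 (normr_ge0 q) q_lt1.
exists M => // i k; have [ik|ki] := ltnP i k.
  by rewrite qfall_root // mulr0 normr0 mulr_ge0 ?exprn_ge0 // ltW.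
apply: le_trans (_ : (\prod_(0 <= m < k)
    (1 + 2 * `|h * b| / `|q| * `|q| ^+ m)) * `|q| ^+ k <= _); last first.
  by rewrite ler_wpM2r ?exprn_ge0.
have E x : x ^+ k = \prod_(0 <= m < k) x by rewrite prodr_const_nat subn0.
rewrite !E -!big_split /= normr_prod big_seq [leRHS]big_seq.
apply: ler_prod => m; rewrite mem_index_iota /= => mk.
rewrite normr_ge0 /=.
have -> : (1 + 2 * `|h * b| / `|q| * `|q| ^+ m) * `|q| =
    `|q| + `|h * b| * `|q| ^+ m * 2 by field.
apply: ler_wpDl => //; rewrite -mulrBr mulrA normrM -mulrA ler_wpM2l //.
apply: le_trans (ler_normB _ _) _; rewrite !normrX mulr_natr mulr2n lerD2r.
by rewrite ler_wiXn2l ?(ltW q_lt1) // (leq_trans (ltnW mk)).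
Qed.

(* [pt_sum] below collects the points [t = b q^i] of the q-integral of
   (qt/a, qt/b, ct, dt)/(et, ft, gt, ht), multiplied by (be, bf, bg, bh)_oo. *)
Definition pt_weight a b e f g i : C :=
  b * oo (q * q ^+ i) * oo (b * q / a * q ^+ i)
  * ((b * e) ^_ i * (b * f) ^_ i * (b * g) ^_ i) * q ^+ i.

Lemma pt_weight_bound a b e f g : exists2 M : C, 0 < M &
  forall i, `|pt_weight a b e f g i| <= M * `|q| ^+ i.
Proof.
have [M M0 hM] : ubounded (fun i => b * oo (q * q ^+ i)
    * oo (b * q / a * q ^+ i) * ((b * e) ^_ i * (b * f) ^_ i * (b * g) ^_ i)).
  have h x : ubounded (fun i => oo (x * q ^+ i)).
    apply: ubounded_qpochoo => //; apply: uboundedM; first exact: ubounded_cst.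
    exact: ubounded_exprn.
  have h' x : ubounded (fun i => x ^_ i).
    by apply: ubounded_qpoch => //; exact: ubounded_cst.
  by repeat (apply: uboundedM => //); exact: ubounded_cst.
exists M => // i; apply: ler_normM; first exact: hM.
by rewrite normrX.
Qed.

Lemma pt_weight_dominated a b e f g (Y : nat -> C) : ubounded Y ->
  exists M, dominated M `|q| (fun i => pt_weight a b e f g i * Y i).
Proof.
move=> [M2 M20 h2]; have [M1 M10 h1] := pt_weight_bound a b e f g.
exists (M1 * M2); split => // [|i]; first by rewrite mulr_ge0 // ltW.
by rewrite [leRHS]mulrAC; apply: ler_normM; [exact: h1|exact: h2].
Qed.

Lemma ubounded_qfall p b r k : ubounded (fun i =>
  qfall (p * q ^+ i) b k * oo (r * (p * q ^+ i) * q ^+ k)).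
Proof.
have h : ubounded (fun i => p * q ^+ i).
  by apply: uboundedM; [exact: ubounded_cst|exact: ubounded_exprn].
apply: uboundedM; last first.
  apply: ubounded_qpochoo => //; apply: uboundedM; last exact: ubounded_cst.
  by apply: uboundedM => //; exact: ubounded_cst.
elim: k => [|k IH].
  by rewrite /qfall; under eq_fun do rewrite big_nil; exact: ubounded_cst.
rewrite /qfall; under eq_fun do rewrite big_nat_recr //=.
by apply: uboundedM => //; apply: uboundedB => //; exact: ubounded_cst.
Qed.

(** The points b q^i with i < k are roots of [qfall]. The others, i = k + j, are the points of the
    integral with endpoint b q^k, and a b e f g q^k is the numerator parameter which that integral
    requires. *)
Lemma sumoo_inner a b e f g k : a != 0 -> b != 0 ->
  sumoo (fun i => pt_weight a b e f g i * (qfall (b * q ^+ i) b k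
    * oo (a * b * e * f * g * (b * q ^+ i) * q ^+ k))) =
  qsign b k * ((b * e) ^_ k * (b * f) ^_ k * (b * g) ^_ k)
    * av_sum q a (b * q ^+ k) e f g.
Proof.
move=> a0 b0; set F := (F in sumoo F).
have [M dM] := pt_weight_dominated a b e f g
  (ubounded_qfall b b (a * b * e * f * g) k).
rewrite (sumoo_split C_complete k dM) big_seq big1 ?add0r => [|i]; last first.
  by rewrite mem_index_iota /= => ik; rewrite /F qfall_root // !(mul0r, mulr0).
have [M' dM'] := av_dominated C_complete q_lt1 a (b * q ^+ k) f g (normr_ge0 e).
rewrite -(sumooZ C_complete _ (dM' e (lexx _))); apply: eq_sumoo => j.
rewrite /F /pt_weight /av_term.
have H := qfall_qpochoo (b * q ^+ (k + j)) k b0.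
have qk : q ^+ k != 0 by rewrite expf_neq0.
have E1 : b * q ^+ (k + j) * q / b = q * q ^+ (k + j) by field; rewrite b0.
have E2 : b * q ^+ (k + j) * q / (b * q ^+ k) = q * q ^+ j.
  by rewrite exprD; field; rewrite b0 qk.
move: H; rewrite E1 E2 => H.
rewrite !qpochD.
have -> : a * b * e * f * g * (b * q ^+ (k + j)) * q ^+ k =
  a * (b * q ^+ k) * e * f * g * (b * q ^+ k) * q ^+ j by rewrite exprD; ring.
have -> : b * q / a * q ^+ (k + j) = b * q ^+ k * q / a * q ^+ j.
  by rewrite exprD; ring.
have E x : b * q ^+ k * x = b * x * q ^+ k by ring.
rewrite !E.
transitivity ((oo (q * q ^+ (k + j)) * qfall (b * q ^+ (k + j)) b k) *
  (b * oo (b * q * q ^+ k / a * q ^+ j)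
   * ((b * e) ^_ k * (b * e * q ^+ k) ^_ j * ((b * f) ^_ k * (b * f * q ^+ k) ^_ j)
     * ((b * g) ^_ k * (b * g * q ^+ k) ^_ j)) * q ^+ (k + j)
   * oo (a * (b * q ^+ k) * e * f * g * (b * q ^+ k) * q ^+ j))).
  by rewrite -!E; ring.
by rewrite H exprD; ring.
Qed.

(** Here no point is lost: only the factor attached to the opposite endpoint changes, from b to b
    q^k. *)
Lemma sumoo_outer a b e f g k : a != 0 -> b != 0 ->
  sumoo (fun i => pt_weight b a e f g i * (qfall (a * q ^+ i) b k
    * oo (a * b * e * f * g * (a * q ^+ i) * q ^+ k))) =
  qsign b k * av_sum q (b * q ^+ k) a e f g.
Proof.
move=> a0 b0.
have [M' dM'] := av_dominated C_complete q_lt1 (b * q ^+ k) a f g (normr_ge0 e).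
rewrite -(sumooZ C_complete _ (dM' e (lexx _))); apply: eq_sumoo => i.
rewrite /pt_weight /av_term.
have H := qfall_qpochoo (a * q ^+ i) k b0.
have E x : a * q ^+ i * q / x = a * q / x * q ^+ i by ring.
move: H; rewrite !E => H.
have -> : a * b * e * f * g * (a * q ^+ i) * q ^+ k =
  b * q ^+ k * a * e * f * g * a * q ^+ i by ring.
transitivity ((oo (a * q / b * q ^+ i) * qfall (a * q ^+ i) b k) *
  (a * oo (q * q ^+ i) * ((a * e) ^_ i * (a * f) ^_ i * (a * g) ^_ i) * q ^+ i
   * oo (b * q ^+ k * a * e * f * g * a * q ^+ i))); first by ring.
by rewrite H; ring.
Qed.

(** The part independent of t of the 6phi5 coefficient with al = bcd/(hq) and parameters c/h, d/h,
    b/t. With these values the argument is th and the sum is (bcd/h, bh, ct, dt)_oo / (ht)_oo. *)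
Definition vwp_coef b c d h k : C :=
  vwp q (b * c * d / (h * q)) k * ((c / h) ^_ k * (d / h) ^_ k / q ^_ k)
  * (oo (b * d * q ^+ k) * oo (b * c * q ^+ k)).

Lemma phi65_termE a b c d h t k :
  b != 0 -> c != 0 -> d != 0 -> h != 0 -> t != 0 ->
  phi65_term q (b * c * d / (h * q)) (c / h) (d / h) (b / t) k =
  vwp_coef b c d h k
    * (h ^+ k * qfall t b k * oo (c * d / h * t * q ^+ k)).
Proof.
move=> b0 c0 d0 h0 t0; rewrite /phi65_term /phi65_coef /vwp_coef -qfallE //.
have -> : b * c * d / (h * q) * q / (c / h) = b * d by field; rewrite c0 h0 q_neq0.
have -> : b * c * d / (h * q) * q / (d / h) = b * c by field; rewrite d0 h0 q_neq0.
have -> : b * c * d / (h * q) * q / (b / t) = c * d / h * t.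
  by field; rewrite b0 h0 q_neq0 t0.
have -> : b * c * d / (h * q) * q / (c / h * (d / h) * (b / t)) = h * t.
  by field; rewrite b0 c0 d0 h0 q_neq0 t0.
by rewrite exprMn; ring.
Qed.

Lemma ubounded_vwp_coef b c d h : ubounded (vwp_coef b c d h).
Proof.
have h1 x : ubounded (fun k => x ^_ k).
  by apply: ubounded_qpoch => //; exact: ubounded_cst.
have h2 x : ubounded (fun k => oo (x * q ^+ k)).
  apply: ubounded_qpochoo => //; apply: uboundedM; first exact: ubounded_cst.
  exact: ubounded_exprn.
apply: uboundedM; last exact: uboundedM.
apply: uboundedM; last first.
  by apply: uboundedM; [exact: uboundedM|exact: ubounded_invq].
by apply: ubounded_vwp => //; exact: ubounded_cst.
Qed.

Definition pt_sum a b c d e f g h : C :=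
  sumoo (fun i => pt_weight a b e f g i
    * ((b * h) ^_ i * (oo (b * c * q ^+ i) * oo (b * d * q ^+ i)))).

(** The q-integral from a to b, multiplied by (ae, af, ag, ah, be, bf, bg, bh)_oo / (1 - q). *)
Definition pt_diff a b c d e f g h : C :=
  oo (a * e) * oo (a * f) * oo (a * g) * oo (a * h) * pt_sum a b c d e f g h
  - oo (b * e) * oo (b * f) * oo (b * g) * oo (b * h) * pt_sum b a c d e f g h.

Definition expansion_term b c d h t k : C :=
  vwp_coef b c d h k * (h ^+ k * qfall t b k * oo (c * d / h * t * q ^+ k)).

Lemma expansion_inner b c d h i : b != 0 -> c != 0 -> d != 0 -> h != 0 ->
  sumoo (expansion_term b c d h (b * q ^+ i)) = oo (b * c * d / h)
    * ((b * h) ^_ i * (oo (b * c * q ^+ i) * oo (b * d * q ^+ i))).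
Proof.
move=> b0 c0 d0 h0; have qi : q ^+ i != 0 by rewrite expf_neq0.
rewrite (@sumoo_finite _ i.+1) => [|k ik]; last first.
  by rewrite /expansion_term qfall_root // !(mul0r, mulr0).
have bt : b / (b * q ^+ i) = q ^- i by field; rewrite b0 qi.
under eq_bigr do rewrite /expansion_term -phi65_termE ?mulf_neq0 // bt.
rewrite phi65_finite_sum ?mulf_neq0 ?invr_eq0 //.
have -> : b * c * d / (h * q) * q = b * c * d / h by field; rewrite h0 q_neq0.
have -> : b * c * d / h / (c / h * (d / h)) = b * h by field; rewrite c0 d0 h0.
have -> : b * c * d / h / (c / h) = b * d by field; rewrite c0 h0.
have -> : b * c * d / h / (d / h) = b * c by field; rewrite d0 h0.
by ring.
Qed.

Lemma expansion_outer b c d h t : b != 0 -> c != 0 -> d != 0 -> h != 0 ->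
  t != 0 -> `|t * h| < 1 ->
  oo (t * h) * sumoo (expansion_term b c d h t) =
  oo (b * c * d / h) * oo (b * h) * (oo (t * c) * oo (t * d)).
Proof.
move=> b0 c0 d0 h0 t0 th1.
rewrite (@eq_sumoo _ _ (phi65_term q (b * c * d / (h * q)) (c / h) (d / h) (b / t)));
  last by move=> k; rewrite phi65_termE.
have Ez : b * c * d / (h * q) * q / (c / h * (d / h) * (b / t)) = t * h.
  by field; rewrite b0 c0 d0 h0 q_neq0 t0.
rewrite -Ez phi65_sum ?mulf_neq0 ?invr_eq0 // ?Ez //.
have -> : b * c * d / (h * q) * q / (c / h * (d / h)) = b * h.
  by field; rewrite c0 d0 h0 q_neq0.
have -> : b * c * d / (h * q) * q / (c / h * (b / t)) = t * d.
  by field; rewrite b0 c0 h0 q_neq0 t0.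
have -> : b * c * d / (h * q) * q / (d / h * (b / t)) = t * c.
  by field; rewrite b0 d0 h0 q_neq0 t0.
have -> : b * c * d / (h * q) * q = b * c * d / h by field; rewrite h0 q_neq0.
by ring.
Qed.

Lemma expansion_bound b c d h p M s (X : nat -> C) :
  0 < M -> (forall i k, `|h ^+ k * qfall (X i) b k| <= M * s ^+ k) ->
  (forall i, `|X i| <= p) -> 0 <= s ->
  exists2 M', 0 < M' & forall i k,
    `|expansion_term b c d h (X i) k| <= M' * s ^+ k.
Proof.
move=> M0 hM Xp s0; have [M1 M10 h1] := ubounded_vwp_coef b c d h.
have [M2 M20 h2] : ubounded (fun ik : nat * nat =>
    oo (c * d / h * X ik.1 * q ^+ ik.2)).
  apply: ubounded_qpochoo => //; apply: uboundedM; last exact: ubounded_exprn.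
  apply: uboundedM; first exact: ubounded_cst.
  by apply: (@ubounded_le _ _ _ p) => -[].
exists (M1 * M * M2) => [|i k]; first by rewrite !mulr_gt0.
have -> : M1 * M * M2 * s ^+ k = M1 * (M * s ^+ k * M2) by ring.
apply: ler_normM; first exact: h1.
by apply: ler_normM; [exact: hM|exact: (h2 (i, k))].
Qed.

(** Besides the exchange it gives domination of the resulting series, which is needed to scale and
    subtract such series later. *)
Lemma weighted_exchange (w : nat -> C) (Y : nat -> nat -> C) M M' s :
  0 < M -> 0 < M' -> 0 <= s -> s < 1 ->
  (forall i, `|w i| <= M * `|q| ^+ i) -> (forall i k, `|Y i k| <= M' * s ^+ k) ->
  (exists K, dominated K s (fun k => sumoo (fun i => w i * Y i k))) /\
  sumoo (fun i => w i * sumoo (Y i)) =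
    sumoo (fun k => sumoo (fun i => w i * Y i k)).
Proof.
move=> M0 M'0 s0 s1 hw hY.
have b i k : `|w i * Y i k| <= M * M' * `|q| ^+ i * s ^+ k.
  have -> : M * M' * `|q| ^+ i * s ^+ k = M * `|q| ^+ i * (M' * s ^+ k) by ring.
  exact: ler_normM.
have MM : 0 <= M * M' by rewrite mulr_ge0 // ltW.
have q10 : 0 <= 1 - `|q| by rewrite subr_ge0 ltW.
split.
  exists (M * M' / (1 - `|q|)); split => // [|k]; first exact: divr_ge0.
  rewrite mulrAC; apply: (@dominated_sumoo_le _ C_complete); split => // [|i].
    by rewrite mulr_ge0 ?exprn_ge0.
  by rewrite mulrAC.
rewrite -(@sumoo_exchange _ C_complete (M * M') `|q| s) //.
apply: eq_sumoo => i; apply/esym.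
by apply: (@sumooZ _ C_complete M' s); split => //; exact: ltW.
Qed.

(** Expand at each point b q^i by the terminating sum, then exchange. The relation between the
    parameters turns cd/h into abefg, as [sumoo_inner] requires. *)
Lemma pt_sum_inner a b c d e f g h :
  a != 0 -> b != 0 -> c != 0 -> d != 0 -> h != 0 ->
  c * d = a * b * e * f * g * h ->
  let S k := vwp_coef b c d h k * h ^+ k * (qsign b k
    * ((b * e) ^_ k * (b * f) ^_ k * (b * g) ^_ k)
    * av_sum q a (b * q ^+ k) e f g) in
  (exists K r, dominated K r S) /\
  oo (b * c * d / h) * pt_sum a b c d e f g h = sumoo S.
Proof.
move=> a0 b0 c0 d0 h0 bal S.
have [M1 M10 h1] := pt_weight_bound a b e f g.
have [M2 M20 h2] := qfall_bound_inner b h.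
have [|M3 M30 h3] := @expansion_bound b c d h `|b| M2 `|q| (fun i => b * q ^+ i)
  M20 h2 _ (normr_ge0 q).
  by move=> i; exact: normr_exprn_le.
have [[K dK] H] := weighted_exchange M10 M30 (normr_ge0 q) q_lt1 h1 h3.
have ES k : sumoo (fun i => pt_weight a b e f g i
    * expansion_term b c d h (b * q ^+ i) k) = S k.
  have [M dM] := pt_weight_dominated a b e f g
    (ubounded_qfall b b (a * b * e * f * g) k).
  rewrite /S -sumoo_inner // -(sumooZ C_complete _ dM); apply: eq_sumoo => i.
  by rewrite /expansion_term bal mulfK //; ring.
split; first by exists K, `|q|; rewrite -(funext ES).
rewrite -(funext ES) -H; apply/esym.
have [M dM] : exists M, dominated M `|q| (fun i => pt_weight a b e f g i
    * ((b * h) ^_ i * (oo (b * c * q ^+ i) * oo (b * d * q ^+ i)))).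
  have hb x : ubounded (fun i => oo (x * q ^+ i)).
    apply: ubounded_qpochoo => //; apply: uboundedM; first exact: ubounded_cst.
    exact: ubounded_exprn.
  apply: pt_weight_dominated; apply: uboundedM; last exact: uboundedM.
  by apply: ubounded_qpoch => //; exact: ubounded_cst.
rewrite /pt_sum -(sumooZ C_complete _ dM); apply: eq_sumoo => i.
by rewrite expansion_inner //; ring.
Qed.

(** Same exchange at the points a q^i, now with the nonterminating sum. It supplies (ah q^i)_oo,
    which (ah)_i completes to (ah)_oo. *)
Lemma pt_sum_outer a b c d e f g h :
  a != 0 -> b != 0 -> c != 0 -> d != 0 -> h != 0 ->
  c * d = a * b * e * f * g * h -> `|a * h| < 1 ->
  let S k := vwp_coef b c d h k * h ^+ k
    * (qsign b k * av_sum q (b * q ^+ k) a e f g) in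
  (exists K r, dominated K r S) /\
  oo (b * c * d / h) * oo (b * h) * pt_sum b a c d e f g h = oo (a * h) * sumoo S.
Proof.
move=> a0 b0 c0 d0 h0 bal ah1 S.
have [M1 M10 h1] := pt_weight_bound b a e f g.
have [M2 M20 h2] := qfall_bound_outer b a0.
have h2' i k : `|h ^+ k * qfall (a * q ^+ i) b k| <= M2 * `|a * h| ^+ k.
  have -> : M2 * `|a * h| ^+ k = `|h| ^+ k * (M2 * `|a| ^+ k).
    by rewrite normrM exprMn; ring.
  by apply: ler_normM; rewrite ?normrX.
have [|M3 M30 h3] := @expansion_bound b c d h `|a| M2 `|a * h| (fun i => a * q ^+ i)
  M20 h2' _ (normr_ge0 _).
  by move=> i; exact: normr_exprn_le.
have [[K dK] H] := weighted_exchange M10 M30 (normr_ge0 _) ah1 h1 h3.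
have ES k : sumoo (fun i => pt_weight b a e f g i
    * expansion_term b c d h (a * q ^+ i) k) = S k.
  have [M dM] := pt_weight_dominated b a e f g
    (ubounded_qfall a b (a * b * e * f * g) k).
  rewrite /S -sumoo_outer // -(sumooZ C_complete _ dM); apply: eq_sumoo => i.
  by rewrite /expansion_term bal mulfK //; ring.
split; first by exists K, `|a * h|; rewrite -(funext ES).
rewrite -(funext ES) -H.
have hb x : ubounded (fun i => oo (x * q ^+ i)).
  apply: ubounded_qpochoo => //; apply: uboundedM; first exact: ubounded_cst.
  exact: ubounded_exprn.
have [M dM] : exists M, dominated M `|q| (fun i => pt_weight b a e f g i
    * ((a * h) ^_ i * (oo (a * c * q ^+ i) * oo (a * d * q ^+ i)))).
  apply: pt_weight_dominated; apply: uboundedM; last exact: uboundedM.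
  by apply: ubounded_qpoch => //; exact: ubounded_cst.
have [M' dM'] : exists M, dominated M `|q| (fun i => pt_weight b a e f g i
    * sumoo (expansion_term b c d h (a * q ^+ i))).
  apply: pt_weight_dominated; apply: (@ubounded_le _ _ _ (M3 / (1 - `|a * h|))).
  move=> i; apply: (@dominated_sumoo_le _ C_complete).
  by split => //; exact: ltW.
rewrite /pt_sum -(sumooZ C_complete _ dM) -(sumooZ C_complete _ dM').
apply: eq_sumoo => i.
have qi : q ^+ i != 0 by rewrite expf_neq0.
have E : a * q ^+ i * h = a * h * q ^+ i by ring.
have := @expansion_outer b c d h (a * q ^+ i) b0 c0 d0 h0 (mulf_neq0 a0 qi).
rewrite E => /(_ (le_lt_trans (normr_exprn_le q_lt1 _ _) ah1)) X.
rewrite (qpochoo_split C_complete q_lt1 (a * h) i).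
transitivity (pt_weight b a e f g i * (a * h) ^_ i * (oo (a * h * q ^+ i) *
  sumoo (expansion_term b c d h (a * q ^+ i)))); last by ring.
rewrite X ![a * q ^+ i * _]mulrAC.
by ring.
Qed.

(* The series 8W7(bcd/(hq); be, bf, bg, c/h, d/h; q, ah) when cd = abefgh, with the
   denominators [al q/b_j] multiplied out to infinite products. *)
Definition vwp_term a b c d e f g h k : C :=
  vwp_coef b c d h k * ((b * e) ^_ k * (b * f) ^_ k * (b * g) ^_ k)
  * (oo (a * b * e * f * q ^+ k) * oo (a * b * e * g * q ^+ k)
     * oo (a * b * f * g * q ^+ k)) * (a * h) ^+ k.

Lemma vwp_term_dominated a b c d e f g h : `|a * h| < 1 ->
  exists M, dominated M `|a * h| (vwp_term a b c d e f g h).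
Proof.
move=> ah1; apply: ubounded_dominated => //.
have h1 x : ubounded (fun k => x ^_ k).
  by apply: ubounded_qpoch => //; exact: ubounded_cst.
have h2 x : ubounded (fun k => oo (x * q ^+ k)).
  apply: ubounded_qpochoo => //; apply: uboundedM; first exact: ubounded_cst.
  exact: ubounded_exprn.
apply: uboundedM; last by do 2?apply: uboundedM.
by apply: uboundedM; [exact: ubounded_vwp_coef|do 2?apply: uboundedM].
Qed.

(** For each k the two expansions combine into the Al-Salam--Verma integral over [a, b q^k], whose
    value is known; [qsign_theta] then removes k from its theta factor. *)
Theorem pt_diffE a b c d e f g h :
  a != 0 -> b != 0 -> c != 0 -> d != 0 -> h != 0 ->
  c * d = a * b * e * f * g * h -> `|a * h| < 1 ->
  oo (b * c * d / h) * pt_diff a b c d e f g h =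
  oo (a * h) * (b * oo q * oo (b * q / a) * oo (a / b))
    * sumoo (vwp_term a b c d e f g h).
Proof.
move=> a0 b0 c0 d0 h0 bal ah1.
have [[K [r dI]] HI] := pt_sum_inner a0 b0 c0 d0 h0 bal.
have [[K' [r' dO]] HO] := pt_sum_outer a0 b0 c0 d0 h0 bal ah1.
set pa := oo (a * e) * oo (a * f) * oo (a * g).
set pb := oo (b * e) * oo (b * f) * oo (b * g).
transitivity (oo (a * h) * (pa * (oo (b * c * d / h) * pt_sum a b c d e f g h))
  - pb * (oo (b * c * d / h) * oo (b * h) * pt_sum b a c d e f g h)).
  by rewrite /pt_diff /pa /pb; ring.
rewrite HI HO [pb * _]mulrCA -mulrBr -[RHS]mulrA; congr (_ * _).
rewrite -(sumooZ C_complete pa dI) -(sumooZ C_complete pb dO).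
have [M dV] := vwp_term_dominated b c d e f g ah1.
rewrite -(sumooZ C_complete _ dV).
apply: (cvgn_unique (sumooB C_complete (dominatedZ pa dI) (dominatedZ pb dO))).
rewrite (_ : (fun n => _) = (fun n => \sum_(0 <= k < n)
    b * oo q * oo (b * q / a) * oo (a / b) * vwp_term a b c d e f g h k)).
  exact: (dominated_lim C_complete (dominatedZ _ dV)).
apply/funext => n; apply: eq_bigr => k _.
have b'0 : b * q ^+ k != 0 by rewrite mulf_neq0 ?expf_neq0.
have := av_diffE C_complete q_lt1 e f g a0 b'0; rewrite /av_diff -/pa => AV.
have E x : b * x * q ^+ k = b * q ^+ k * x by ring.
(* Splitting off the first k factors exposes (be, bf, bg)_k as a common factor of both sums. *)
have -> : pb = (b * e) ^_ k * (b * f) ^_ k * (b * g) ^_ k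
    * (oo (b * q ^+ k * e) * oo (b * q ^+ k * f) * oo (b * q ^+ k * g)).
  rewrite /pb (qpochoo_split C_complete q_lt1 (b * e) k).
  rewrite (qpochoo_split C_complete q_lt1 (b * f) k).
  by rewrite (qpochoo_split C_complete q_lt1 (b * g) k) !E; ring.
transitivity (vwp_coef b c d h k * h ^+ k * qsign b k
    * ((b * e) ^_ k * (b * f) ^_ k * (b * g) ^_ k)
    * (pa * av_sum q a (b * q ^+ k) e f g
       - oo (b * q ^+ k * e) * oo (b * q ^+ k * f) * oo (b * q ^+ k * g)
         * av_sum q (b * q ^+ k) a e f g)); first by ring.
rewrite AV.
have T := qsign_theta k a0 b0.
have E' x y : a * (b * q ^+ k) * x * y = a * b * x * y * q ^+ k by ring.
rewrite !E' /vwp_term exprMn.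
transitivity (vwp_coef b c d h k * h ^+ k
    * ((b * e) ^_ k * (b * f) ^_ k * (b * g) ^_ k) * b * oo q
    * (oo (a * b * e * f * q ^+ k) * oo (a * b * e * g * q ^+ k)
       * oo (a * b * f * g * q ^+ k))
    * (qsign b k * (q ^+ k * oo (b * q ^+ k * q / a) * oo (a / (b * q ^+ k))))).
  by ring.
by rewrite T; ring.
Qed.

End TwoPointIntegral.

(** * Three-term relation *)

Section ThreeTerm.
Local Open Scope classical_set_scope.
Variable C : numClosedFieldType.
Hypothesis C_complete : geo_complete C.
Variable q : C.
Hypothesis q_neq0 : q != 0.
Hypothesis q_lt1 : `|q| < 1.
Implicit Types (x y z t a b c d e f g h : C) (n k i : nat).

Local Notation "x ^_ n" := (qpoch x q n).
Local Notation oo x := (qpochoo x q).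

(** Converts the nonvanishing denominators of all the terms of a series into nonvanishing infinite
    products. *)
Lemma qpochoo_neq0_finite x : (forall n, x ^_ n != 0) -> oo x != 0.
Proof.
move=> xn; have /cvgrPdist_lt/(_ _ ltr01) near1 := qpochoo_cvg1 C_complete q_lt1 x.
near \oo => N.
have h : `|1 - oo (x * q ^+ N)| < 1 by near: N.
rewrite (qpochoo_split C_complete q_lt1 x N) mulf_neq0 //.
by apply: contraTneq h => ->; rewrite subr0 normr1 ltxx.
Unshelve. all: by end_near. Qed.

(** The integrand is symmetric in the factors qt/a and qt/s, and at the points b q^i nothing else
    involves a or s. *)
Lemma pt_sum_swap a b s d e f g h :
  pt_sum q a b (q / s) d e f g h = pt_sum q s b (q / a) d e f g h.
Proof.
apply: eq_sumoo => i; rewrite /pt_weight.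
have E x : b * (q / x) = b * q / x by ring.
by rewrite !E; ring.
Qed.

Lemma pt_sum_rot a b c d e f g h :
  pt_sum q a b c d e f g h = pt_sum q a b c d f g h e.
Proof. by apply: eq_sumoo => i; rewrite /pt_weight; ring. Qed.

(** Additivity of the integral: the six sums are three sums, one per endpoint, each occurring twice,
    and those at b cancel. The parameters on the right are rotated so that e takes the place of
    h. *)
Lemma pt_diff_three_term a b s d e f g h :
  oo (s * e) * oo (s * f) * oo (s * g) * oo (s * h)
    * pt_diff q a b (q / s) d e f g h
  - oo (a * e) * oo (a * f) * oo (a * g) * oo (a * h)
    * pt_diff q s b (q / a) d e f g h
  = oo (b * e) * oo (b * f) * oo (b * g) * oo (b * h)
    * pt_diff q a s (q / b) d f g h e.
Proof.
rewrite /pt_diff -(pt_sum_swap a b s) -(pt_sum_rot a s) -(pt_sum_rot s a).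
rewrite (pt_sum_swap a s b) (pt_sum_swap s a b).
by ring.
Qed.

(** * Identification of the three series of the theorem *)

Section Specialization.
Variables a c u v x y : C.
Hypothesis a0 : a != 0.
Hypothesis c0 : c != 0.
Hypothesis u0 : u != 0.
Hypothesis v0 : v != 0.
Hypothesis x0 : x != 0.
Hypothesis y0 : y != 0.

Local Notation A := (q * v / y).
Local Notation B := (c * u * v).
Local Notation S := u.
Local Notation D := (x / (c * v)).
Local Notation E := (y / (c * u * v)).
Local Notation F := a.
Local Notation G := (x / (a * c * u * v ^+ 2)).
Local Notation H := (1 : C).

Let oo_split w n : oo w = w ^_ n * oo (w * q ^+ n).
Proof. exact: qpochoo_split. Qed.

(** The pair (A, B), with c = q/S and h = 1. The products on the left are those by which [vwp_term]
    has been multiplied out; 1 - x appears because [vwp] has it divided out. *)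
Lemma lhs1_termE k :
  (forall k, lhs1_den1 q a c v k != 0) ->
  (forall k, lhs1_den2 q a c u v x y k != 0) ->
  lhs1_term q a c u v x y k
    * (oo (a * v) * oo (c * v) * oo (x * u) * oo (x * q / y)
       * oo (x / (a * c * u * v)))
  = (1 - x) * vwp_term q A B (q / S) D E F G H k.
Proof.
rewrite /lhs1_term /lhs1_den1 /lhs1_den2 /vwp_term /vwp_coef /qpochs.
move=> /(_ k); rewrite !big_cons !big_nil !mulr1 mulf_eq0 negb_or => /andP[n1 n2].
move=> /(_ k); rewrite !big_cons !big_nil !mulr1 !mulf_eq0 !negb_or.
move=> /andP[/and3P[n3 n4 n5] n6].
have H0 := (q_neq0, a0, c0, u0, v0, y0).
have -> : B * (q / S) * D / (H * q) = x by field; rewrite !H0.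
have -> : q / S / H = q / u by rewrite divr1.
have -> : D / H = x / (c * v) by rewrite divr1.
have -> : B * D = x * u by field; rewrite !H0.
have -> : B * (q / S) = c * v * q by field; rewrite !H0.
have -> : B * E = y by field; rewrite !H0.
have -> : B * F = a * c * u * v by ring.
have -> : B * G = x / (a * v) by field; rewrite !H0.
have -> : A * B * E * F = a * v * q by field; rewrite !H0.
have -> : A * B * E * G = x / (a * c * u * v) * q by field; rewrite !H0.
have -> : A * B * F * G = x * q / y by field; rewrite !H0.
rewrite (oo_split (a * v) k.+1) (oo_split (c * v) k.+1) (oo_split (x * u) k).
rewrite (oo_split (x * q / y) k) (oo_split (x / (a * c * u * v)) k.+1).
(* The product of wq from index k on is that of w from index k + 1 on, the tail left by the factors
   with k + 1 terms. *)
rewrite -!(mulrA _ q (q ^+ k)) -exprS.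
have V := vwpE q x k.
have -> : (q * v / y) ^+ k = v ^+ k * (q / y) ^+ k.
  by rewrite -exprMn; congr (_ ^+ k); ring.
have -> : q ^+ (2 * k) * x = x * q ^+ k ^+ 2 by rewrite mulnC exprM mulrC.
move: V; move: (1 - _ * q ^+ k ^+ 2) => z3 V.
rewrite !mulrA -V.
move: n1 n2 n3 n4 n5 n6.
move: ((a * v) ^_ k.+1) ((c * v) ^_ k.+1) (q ^_ k) ((x * u) ^_ k)
  ((x * q / y) ^_ k) ((x / (a * c * u * v)) ^_ k.+1) => w1 w2 w3 w4 w5 w6.
move: ((q / y) ^+ k) (v ^+ k) => z1 z2 *.
by field; do ?[apply/andP; split].
Qed.

Local Notation al2 := (x * y * u / (v * q)).

Lemma lhs2_termE k :
  (forall k, lhs2_den1 q a c u y k != 0) ->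
  (forall k, lhs2_den2 q a c u v x y k != 0) ->
  lhs2_term q a c u v x y k
    * (oo (y * a * u / q) * oo (y * c * u / q) * oo (x * u) * oo (x * u / v)
       * oo (x * y / (a * c * v ^+ 2 * q)))
  = (1 - al2) * vwp_term q S B (q / A) D E F G H k.
Proof.
rewrite /lhs2_term /lhs2_den1 /lhs2_den2 /vwp_term /vwp_coef /qpochs.
move=> /(_ k); rewrite !big_cons !big_nil !mulr1 mulf_eq0 negb_or => /andP[n1 n2].
move=> /(_ k); rewrite !big_cons !big_nil !mulr1 !mulf_eq0 !negb_or.
move=> /andP[/and3P[n3 n4 n5] n6].
have H0 := (q_neq0, a0, c0, u0, v0, y0).
have -> : B * (q / A) * D / (H * q) = al2 by field; rewrite !H0.
have -> : q / A / H = y / v by field; rewrite !H0.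
have -> : D / H = x / (c * v) by rewrite divr1.
have -> : B * D = x * u by field; rewrite !H0.
have -> : B * (q / A) = y * c * u / q * q by field; rewrite !H0.
have -> : B * E = y by field; rewrite !H0.
have -> : B * F = a * c * u * v by ring.
have -> : B * G = x / (a * v) by field; rewrite !H0.
have -> : S * B * E * F = y * a * u / q * q by field; rewrite !H0.
have -> : S * B * E * G = x * y / (a * c * v ^+ 2 * q) * q by field; rewrite !H0.
have -> : S * B * F * G = x * u / v by field; rewrite !H0.
rewrite (oo_split (y * a * u / q) k.+1) (oo_split (y * c * u / q) k.+1).
rewrite (oo_split (x * u) k) (oo_split (x * u / v) k).
rewrite (oo_split (x * y / (a * c * v ^+ 2 * q)) k.+1).
rewrite -!(mulrA _ q (q ^+ k)) -exprS.
have V := vwpE q al2 k.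
have -> : q ^ ((2 * k)%:Z - 1) * (x * y * u / v) = al2 * q ^+ k ^+ 2.
  rewrite expfzDr // -exprnP exprN1 mulnC exprM.
  by field; rewrite !H0.
move: V; move: (1 - _ * q ^+ k ^+ 2) => z3 V.
move: n1 n2 n3 n4 n5 n6.
move: ((y * a * u / q) ^_ k.+1) ((y * c * u / q) ^_ k.+1) (q ^_ k)
  ((x * u) ^_ k) ((x * u / v) ^_ k) ((x * y / (a * c * v ^+ 2 * q)) ^_ k.+1)
  => w1 w2 w3 w4 w5 w6.
move: (u ^+ k) => z1 *.
rewrite !mulrA -V.
by field; do ?[apply/andP; split].
Qed.

Local Notation al3 := (x * u / (y * c * v)).

(** The pair (A, S), with c = q/B and with E in the role of h, which changes the argument to AE =
    q/(cu). *)
Lemma W87_termE k :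
  (forall k, W87_den al3 (q / y) (x * u / y) (x / (a * c * v ^+ 2)) u (a * u)
     q k != 0) ->
  W87_term al3 (q / y) (x * u / y) (x / (a * c * v ^+ 2)) u (a * u) q
      (q / (c * u)) k
    * (oo (x * u / (c * v)) * oo (q / (c * v)) * oo (a * u * v * q / y)
       * oo (x * q / (y * c * v)) * oo (x * q / (y * a * c * v)))
  = vwp_term q A S (q / B) D F G H E k.
Proof.
move=> den; have H0 := (q_neq0, a0, c0, u0, v0, y0, x0).
(* The denominator at k = 1 contains both factors, so 1 - [al3] is nonzero. *)
have s1 : (1 - sqrtC al3) * (1 + sqrtC al3) != 0.
  have := den 1%N; rewrite /W87_den /qpochs !big_cons !mulf_eq0 !negb_or.
  rewrite !qpochS !qpoch0n !expr0 !mulr1 !mul1r opprK.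
  by case/and4P => _ -> ->.
have al3E : al3 = sqrtC al3 ^+ 2 by rewrite sqrtCK.
move: (den k).
rewrite /W87_term /W87_num /W87_den /vwp_term /vwp_coef /qpochs.
rewrite !big_cons !big_nil !mulr1 !mulf_eq0 !negb_or.
move=> /andP[n1 /andP[n2 /andP[n3]]].
have -> : al3 * q / (q / y) = x * u / (c * v) by field; rewrite !H0.
have -> : al3 * q / (x * u / y) = q / (c * v) by field; rewrite !H0.
have -> : al3 * q / (x / (a * c * v ^+ 2)) = a * u * v * q / y.
  by field; rewrite !H0.
have -> : al3 * q / u = x * q / (y * c * v) by field; rewrite !H0.
have -> : al3 * q / (a * u) = x * q / (y * a * c * v) by field; rewrite !H0.
move=> /andP[n4 /andP[n5 /andP[n6 /andP[n7 n8]]]].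
have -> : S * (q / B) * D / (E * q) = al3 by field; rewrite !H0.
have -> : q / B / E = q / y by field; rewrite !H0.
have -> : D / E = x * u / y by field; rewrite !H0.
have -> : S * D = x * u / (c * v) by field; rewrite !H0.
have -> : S * (q / B) = q / (c * v) by field; rewrite !H0.
have -> : S * F = a * u by ring.
have -> : S * G = x / (a * c * v ^+ 2) by field; rewrite !H0.
have -> : A * S * F * G = x * q / (y * c * v) by field; rewrite !H0.
have -> : A * S * F = a * u * v * q / y by field; rewrite !H0.
have -> : A * S * G = x * q / (y * a * c * v) by field; rewrite !H0.
have -> : A * E = q / (c * u) by field; rewrite !H0.
rewrite (oo_split (x * u / (c * v)) k) (oo_split (q / (c * v)) k).
rewrite (oo_split (a * u * v * q / y) k) (oo_split (x * q / (y * c * v)) k).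
rewrite (oo_split (x * q / (y * a * c * v)) k).
(* The very-well-poised quotient, multiplied out. Both sides are compared after multiplication by 1
   - [al3], which creates the factors needed to shift each square-root product by one. *)
have V : al3 ^_ k * ((q * sqrtC al3) ^_ k * (- (q * sqrtC al3)) ^_ k)
    = vwp q al3 k * (sqrtC al3 ^_ k * (- sqrtC al3) ^_ k).
  have T s : (1 - s) * (q * s) ^_ k = s ^_ k * (1 - s * q ^+ k).
    by rewrite -qpochS qpochSl [q * s]mulrC.
  apply: (mulfI s1); have T1 := T (sqrtC al3); have T2 := T (- sqrtC al3).
  rewrite opprK mulrN in T2.
  transitivity (al3 ^_ k * (((1 - sqrtC al3) * (q * sqrtC al3) ^_ k)
    * ((1 + sqrtC al3) * (- (q * sqrtC al3)) ^_ k))); first by ring.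
  rewrite T1 T2.
  transitivity ((al3 ^_ k * (1 - sqrtC al3 ^+ 2 * q ^+ k ^+ 2))
    * (sqrtC al3 ^_ k * (- sqrtC al3) ^_ k)); first by ring.
  rewrite sqrtCK vwpE.
  have -> : (1 - sqrtC al3) * (1 + sqrtC al3) = 1 - al3.
    by rewrite [in RHS]al3E; ring.
  by rewrite -[LHS]mulrA.
move: n1 n2 n3 n4 n5 n6 n7 n8 V.
move: (q ^_ k) (sqrtC al3 ^_ k) ((- sqrtC al3) ^_ k) ((x * u / (c * v)) ^_ k)
  ((q / (c * v)) ^_ k) ((a * u * v * q / y) ^_ k) ((x * q / (y * c * v)) ^_ k)
  ((x * q / (y * a * c * v)) ^_ k) => w1 w2 w3 w4 w5 w6 w7 w8.
move: ((q * sqrtC al3) ^_ k) ((- (q * sqrtC al3)) ^_ k) (al3 ^_ k)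
  (vwp q al3 k) ((q / (c * u)) ^+ k) => p1 p2 p3 p4 zk n1 n2 n3 n4 n5 n6 n7 n8 V.
rewrite [p3 * _](_ : _ = (p3 * (p1 * p2)) * ((q / y) ^_ k *
  ((x * u / y) ^_ k * ((x / (a * c * v ^+ 2)) ^_ k * (u ^_ k * (a * u) ^_ k)))));
  last by ring.
rewrite V.
by field; do ?[apply/andP; split].
Qed.

End Specialization.
End ThreeTerm.

(** * Assembly of the three evaluations *)

Section Evaluation.
Local Open Scope classical_set_scope.
Variable C : numClosedFieldType.
Hypothesis C_complete : geo_complete C.
Implicit Types (q x y z t a b c d e f g h u v : C).

Lemma proportional_sum M r (P p : C) (s t : nat -> C) : P != 0 ->
  (forall k, s k * P = p * t k) -> dominated M r t ->
  summable_seq s /\ sumoo s * P = p * sumoo t.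
Proof.
move=> P0 stP dt; have E : s = (fun k => p / P * t k).
  by apply/funext => k; rewrite mulrAC -stP mulfK.
split; first by rewrite E; exact: C_complete (dominatedZ _ dt).
by rewrite E (sumooZ C_complete _ dt) mulrAC divfK.
Qed.

Theorem three_term_relation q a c u v x y :
  0 < `|q| -> `|q| < 1 -> `|q * v / y| < 1 -> `|u| < 1 -> `|q / (c * u)| < 1 ->
  a != 0 -> c != 0 -> u != 0 -> v != 0 -> x != 0 -> y != 0 ->
  rho_den q a c u v x y != 0 -> c * u - 1 != 0 -> omega_den q c u v x y != 0 ->
  (forall k : nat, lhs1_den1 q a c v k != 0) ->
  (forall k : nat, lhs1_den2 q a c u v x y k != 0) ->
  (forall k : nat, lhs2_den1 q a c u y k != 0) ->
  (forall k : nat, lhs2_den2 q a c u v x y k != 0) ->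
  rhs_den q a c u v x y != 0 ->
  (forall k : nat,
     W87_den (x * u / (y * c * v)) (q / y) (x * u / y) (x / (a * c * v ^+ 2))
       u (a * u) q k != 0) ->
  [/\ summable_seq (lhs1_term q a c u v x y),
      summable_seq (lhs2_term q a c u v x y),
      summable_seq (W87_term (x * u / (y * c * v)) (q / y) (x * u / y)
        (x / (a * c * v ^+ 2)) u (a * u) q (q / (c * u)))
    & v * sumoo (lhs1_term q a c u v x y)
      - u * rho q a c u v x y * sumoo (lhs2_term q a c u v x y)
      = omega q c u v x y * rhs_num q a c u v x y / rhs_den q a c u v x y
        * W87 (x * u / (y * c * v)) (q / y) (x * u / y) (x / (a * c * v ^+ 2))
            u (a * u) q (q / (c * u))].
Proof.
rewrite normr_gt0 => q0 q1 z1 z2 z3 a0 c0 u0 v0 x0 y0.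
rewrite /rho /rho_num /rho_den /omega /omega_num /omega_den /rhs_num /rhs_den.
rewrite /qpochsoo !big_cons !big_nil !mulr1 !mulf_eq0 !negb_or.
case/and4P=> r1 r2 r3 /and5P[r4 r5 r6 r7 r8] cu1 /and4P[_ o2 o3 _].
move=> d11 d12 d21 d22 /and5P[h1 _ _ h4 /and5P[h5 h6 h7 _ _]] dW.
have H0 := (q0, a0, c0, u0, v0, y0, x0).
have oo0 w : (forall n, qpoch w q n != 0) -> qpochoo w q != 0.
  exact: qpochoo_neq0_finite.
have up w : (forall n, qpoch w q n.+1 != 0) -> qpochoo w q != 0.
  by move=> hw; apply: oo0 => -[|n]; rewrite ?qpoch0n ?oner_eq0.
(* The products [l1] to [l4] and those of [w3] are absent from the denominators of the prefactors;
   their nonvanishing comes from the terms of the second and third series. *)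
have l1 : qpochoo (y * a * u / q) q != 0.
  apply: up => n; have := d21 n; rewrite /lhs2_den1 /qpochs !big_cons.
  by rewrite mulf_eq0 negb_or => /andP[].
have l2 : qpochoo (y * c * u / q) q != 0.
  apply: up => n; have := d21 n; rewrite /lhs2_den1 /qpochs !big_cons.
  by rewrite !mulf_eq0 !negb_or => /and3P[].
have l3 : qpochoo (x * u / v) q != 0.
  apply: oo0 => n; have := d22 n; rewrite /lhs2_den2 /qpochs !big_cons.
  by rewrite !mulf_eq0 !negb_or => /andP[/and4P[]].
have l4 : qpochoo (x * y / (a * c * v ^+ 2 * q)) q != 0.
  apply: up => n; have := d22 n; rewrite /lhs2_den2 /qpochs !big_cons.
  by rewrite !mulf_eq0 !negb_or => /andP[].
have w3 : qpochoo (x * u / (c * v)) q * qpochoo (q / (c * v)) q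
    * qpochoo (a * u * v * q / y) q * qpochoo (x * q / (y * c * v)) q
    * qpochoo (x * q / (y * a * c * v)) q != 0.
  have -> : x * u / (c * v) = x * u / (y * c * v) * q / (q / y).
    by field; rewrite !H0.
  have -> : q / (c * v) = x * u / (y * c * v) * q / (x * u / y).
    by field; rewrite !H0.
  have -> : a * u * v * q / y = x * u / (y * c * v) * q / (x / (a * c * v ^+ 2)).
    by field; rewrite !H0.
  have -> : x * q / (y * c * v) = x * u / (y * c * v) * q / u.
    by field; rewrite !H0.
  have -> : x * q / (y * a * c * v) = x * u / (y * c * v) * q / (a * u).
    by field; rewrite !H0.
  rewrite !mulf_neq0 //; apply: oo0 => n; have := dW n;
    rewrite /W87_den /qpochs !big_cons !mulf_eq0 !negb_or;
    by case/and4P => _ _ _ /and5P[? ? ? ? /andP[]].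
have p1 : qpochoo (a * v) q * qpochoo (c * v) q * qpochoo (x * u) q
    * qpochoo (x * q / y) q * qpochoo (x / (a * c * u * v)) q != 0.
  by rewrite !mulf_neq0.
have p2 : qpochoo (y * a * u / q) q * qpochoo (y * c * u / q) q
    * qpochoo (x * u) q * qpochoo (x * u / v) q
    * qpochoo (x * y / (a * c * v ^+ 2 * q)) q != 0.
  by rewrite !mulf_neq0.
have oo1 : (1 : C) != 0 by exact: oner_neq0.
set A := q * v / y; set B := c * u * v; set D := x / (c * v).
set E := y / (c * u * v); set G := x / (a * c * u * v ^+ 2).
have A0 : A != 0 by rewrite /A !mulf_neq0 ?invr_eq0.
have B0 : B != 0 by rewrite /B !mulf_neq0.
have D0 : D != 0 by rewrite /D !mulf_neq0 ?invr_eq0 ?mulf_neq0.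
have E0 : E != 0 by rewrite /E !mulf_neq0 ?invr_eq0 ?mulf_neq0.
have AE : A * E = q / (c * u) by rewrite /A /E; field; rewrite !H0.
have [|M1 dM1] := @vwp_term_dominated _ C_complete q q1 A B (q / u) D E a G 1.
  by rewrite mulr1.
have [|M2 dM2] := @vwp_term_dominated _ C_complete q q1 u B (q / A) D E a G 1.
  by rewrite mulr1.
have [|M3 dM3] := @vwp_term_dominated _ C_complete q q1 A u (q / B) D a G 1 E.
  by rewrite AE.
have [s1 S1] := proportional_sum p1
  (fun k => lhs1_termE C_complete q0 q1 a0 c0 u0 v0 y0 k d11 d12) dM1.
have [s2 S2] := proportional_sum p2
  (fun k => lhs2_termE C_complete q0 q1 a0 c0 u0 v0 y0 k d21 d22) dM2.
have W3 k := etrans (W87_termE C_complete q0 q1 a0 c0 u0 v0 x0 y0 k dW)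
  (esym (mul1r _)).
have [s3 S3] := proportional_sum w3 W3 dM3.
split=> //; rewrite /W87; move: S1 S2 S3.
move: (sumoo (lhs1_term _ _ _ _ _ _ _)) (sumoo (lhs2_term _ _ _ _ _ _ _))
  (sumoo (W87_term _ _ _ _ _ _ _ _)) => T1 T2 T3.
rewrite -/A -/B -/D -/E -/G => S1 S2 S3.
have bal1 : q / u * D = A * B * E * a * G * 1.
  by rewrite /A /B /D /E /G; field; rewrite !H0.
have bal2 : q / A * D = u * B * E * a * G * 1.
  by rewrite /A /B /D /E /G; field; rewrite !H0.
have bal3 : q / B * D = A * u * a * G * 1 * E.
  by rewrite /A /B /D /E /G; field; rewrite !H0.
have quo x' : x' != 0 -> q / x' != 0 by move=> ?; rewrite mulf_neq0 ?invr_eq0.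
have K1 := pt_diffE C_complete q0 q1 A0 B0 (quo _ u0) D0 oo1 bal1.
have K2 := pt_diffE C_complete q0 q1 u0 B0 (quo _ A0) D0 oo1 bal2.
have K3 := pt_diffE C_complete q0 q1 A0 u0 (quo _ B0) D0 E0 bal3.
move: K1 K2 K3; rewrite AE !mulr1 => /(_ z1) K1 /(_ z2) K2 /(_ z3) K3.
have := pt_diff_three_term q A B u D E a G 1.
move: K1 K2 K3.
move: (pt_diff _ _ _ _ _ _ _ _ _) (pt_diff _ _ _ _ _ _ _ _ _)
  (pt_diff _ _ _ _ _ _ _ _ _) => X1 X2 X3.
move: S1 S2 S3; move: (sumoo _) (sumoo _) (sumoo _) => Y1 Y2 Y3.
have -> : B * (q / u) * D / 1 = x * q by rewrite /B /D; field; rewrite !H0.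
have -> : B * (q / A) * D / 1 = x * y * u / v.
  by rewrite /A /B /D; field; rewrite !H0.
have -> : u * (q / B) * D / E = x * u * q / (y * c * v).
  by rewrite /B /D /E; field; rewrite !H0.
have -> : B * q / A = y * c * u by rewrite /A /B; field; rewrite !H0.
have -> : A / B = q / (y * c * u) by rewrite /A /B; field; rewrite !H0.
have -> : B * q / u = c * v * q by rewrite /B; field; rewrite !H0.
have -> : u / B = 1 / (c * v) by rewrite /B; field; rewrite !H0.
have -> : u * q / A = y * u / v by rewrite /A; field; rewrite !H0.
have -> : A / u = v * q / (y * u) by rewrite /A; field; rewrite !H0.
rewrite !mulr1 AE.
have -> : u * E = y / (c * v) by rewrite /E; field; rewrite !H0.
have -> : u * a = a * u by rewrite mulrC.
have -> : u * G = x / (a * c * v ^+ 2) by rewrite /G; field; rewrite !H0.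
have -> : A * a = a * v * q / y by rewrite /A; field; rewrite !H0.
have -> : A * G = x * q / (y * a * c * u * v).
  by rewrite /A /G; field; rewrite !H0.
have -> : B * E = y by rewrite /B /E; field; rewrite !H0.
have -> : B * a = a * c * u * v by rewrite /B; ring.
have -> : B * G = x / (a * v) by rewrite /B /G; field; rewrite !H0.
rewrite /A (_ : q * v / y = v * q / y); last by ring.
rewrite /B.
have S := qpochooS C_complete q1.
(* The products that occur at both w and wq are the only ones linked by relations; these seven
   shifts connect the normalizations of the evaluations with those of [rho] and [omega]. *)
have R1 := S x; have R2 := S (x * y * u / (v * q)); have R3 := S (y * c * u / q).
have R4 := S (q / (y * c * u)); have R5 := S (c * v); have R6 := S (1 / (c * v)).
have R7 := S (1 / (c * u)); move: R1 R2 R3 R4 R5 R6 R7.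
have -> : x * y * u / (v * q) * q = x * y * u / v by field; rewrite !H0.
have -> : y * c * u / q * q = y * c * u by rewrite divfK.
have -> : q / (y * c * u) * q = q ^+ 2 / (y * c * u) by ring.
have -> : 1 / (c * v) * q = q / (c * v) by ring.
have -> : 1 / (c * u) * q = q / (c * u) by ring.
have oq := qpochoo_neq0 C_complete q1 q1.
(* From here on every infinite product is an opaque variable and the claim is a rational
   identity. *)
clear - H0 cu1 r1 r2 r3 r4 r5 r6 r7 r8 o2 o3 l1 l2 l3 l4 h1 h4 h5 h6 h7 oq.
move: r1 r2 r3 r4 r5 r6 r7 r8 o2 o3 l1 l2 l3 l4 h1 h4 h5 h6 h7 oq.
move: (qpochoo (a * v) q) => t1.
move: (qpochoo (c * v) q) => t2.
move: (qpochoo (x * u) q) => t3.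
move: (qpochoo (x * q / y) q) => t4.
move: (qpochoo (x / (a * c * u * v)) q) => t5.
move: (qpochoo (y * a * u / q) q) => t6.
move: (qpochoo (y * c * u / q) q) => t7.
move: (qpochoo (x * u / v) q) => t8.
move: (qpochoo (x * y / (a * c * v ^+ 2 * q)) q) => t9.
move: (qpochoo (x * u / (c * v)) q) => t10.
move: (qpochoo (q / (c * v)) q) => t11.
move: (qpochoo (a * u * v * q / y) q) => t12.
move: (qpochoo (x * q / (y * c * v)) q) => t13.
move: (qpochoo (x * q / (y * a * c * v)) q) => t14.
move: (qpochoo (x * q) q) => t15.
move: (qpochoo (v * q / y) q) => t16.
move: (qpochoo (q) q) => t17.
move: (qpochoo (y * c * u) q) => t18.
move: (qpochoo (q / (y * c * u)) q) => t19.
move: (qpochoo (x * y * u / v) q) => t20.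
move: (qpochoo (u) q) => t21.
move: (qpochoo (c * v * q) q) => t22.
move: (qpochoo (1 / (c * v)) q) => t23.
move: (qpochoo (x * u * q / (y * c * v)) q) => t24.
move: (qpochoo (q / (c * u)) q) => t25.
move: (qpochoo (y * u / v) q) => t26.
move: (qpochoo (v * q / (y * u)) q) => t27.
move: (qpochoo (y / (c * v)) q) => t28.
move: (qpochoo (a * u) q) => t29.
move: (qpochoo (x / (a * c * v ^+ 2)) q) => t30.
move: (qpochoo (a * v * q / y) q) => t31.
move: (qpochoo (x * q / (y * a * c * u * v)) q) => t32.
move: (qpochoo (y) q) => t33.
move: (qpochoo (a * c * u * v) q) => t34.
move: (qpochoo (x / (a * v)) q) => t35.
move: (qpochoo (c * u * v) q) => t36.
move: (qpochoo (x) q) => t37.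
move: (qpochoo (x * y * u / (v * q)) q) => t38.
move: (qpochoo (q ^+ 2 / (y * c * u)) q) => t39.
move: (qpochoo (1 / (c * u)) q) => t40.
move=> n4 n38 n39 n28 n29 n1 n5 n30 n24 n19 n6 n7 n8 n9 n21 n2 n3 n18 n16 n17.
move=> R1 R2 R3 R4 R5 R6 R7 S1 S2 S3 K1 K2 K3 X.
(* These multipliers clear the denominators in the additivity relation [X]: up to the common factor
   t37 t38 t24, the three products with the series are its three terms. *)
pose P1 := t28 * t29 * t30 * t21 * t38 * t24 * t16
  * (c * u * v * t17 * t18 * t19) * (t1 * t2 * t3 * t4 * t5).
pose P2 := t25 * t31 * t32 * t16 * t37 * t24 * t21
  * (c * u * v * t17 * t22 * t23) * (t6 * t7 * t3 * t8 * t9).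
pose P3 := t33 * t34 * t35 * t36 * t37 * t38 * t25
  * (u * t17 * t26 * t27) * (t10 * t11 * t12 * t13 * t14).
have P10 : P1 != 0 by rewrite /P1 !mulf_neq0 ?H0.
have Q1 : P1 * T1 = t28 * t29 * t30 * t21 * t38 * t24 * t37 * X3.
  transitivity (t28 * t29 * t30 * t21 * t38 * t24 * t16
    * (c * u * v * t17 * t18 * t19) * (T1 * (t1 * t2 * t3 * t4 * t5))).
    by rewrite /P1; ring.
  rewrite S1 R1.
  transitivity (t28 * t29 * t30 * t21 * t38 * t24 * (1 - x) * (t15 * X3)).
    by rewrite K1; ring.
  by ring.
have Q2 : P2 * T2 = t25 * t31 * t32 * t16 * t37 * t24 * t38 * X2.
  transitivity (t25 * t31 * t32 * t16 * t37 * t24 * t21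
    * (c * u * v * t17 * t22 * t23) * (T2 * (t6 * t7 * t3 * t8 * t9))).
    by rewrite /P2; ring.
  rewrite S2 R2.
  transitivity (t25 * t31 * t32 * t16 * t37 * t24
    * (1 - x * y * u / (v * q)) * (t20 * X2)).
    by rewrite K2; ring.
  by ring.
have Q3 : P3 * T3 = t33 * t34 * t35 * t36 * t37 * t38 * t24 * X1.
  transitivity (t33 * t34 * t35 * t36 * t37 * t38 * t25
    * (u * t17 * t26 * t27) * (T3 * (t10 * t11 * t12 * t13 * t14))).
    by rewrite /P3; ring.
  rewrite S3 mul1r.
  transitivity (t33 * t34 * t35 * t36 * t37 * t38 * (t24 * X1)).
    by rewrite K3; ring.
  by ring.
have EQ : P1 * T1 - P2 * T2 = P3 * T3.
  rewrite Q1 Q2 Q3.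
  transitivity (t37 * t38 * t24 * (t28 * t29 * t30 * t21 * X3
    - t25 * t31 * t32 * t16 * X2)); first by ring.
  by rewrite X; ring.
clear Q1 Q2 Q3 S1 S2 S3 K1 K2 K3 X.
have n22 : t22 != 0 by apply: contraNneq n2 => t0; rewrite R5 t0 mulr0.
have m1 : 1 - c * v != 0 by apply: contraNneq n2 => t0; rewrite R5 t0 mul0r.
have m2 : y * c * u - q != 0.
  apply: contraNneq n19 => /eqP; rewrite subr_eq0 => /eqP t0.
  by rewrite R4 t0 divff ?H0 // subrr mul0r.
apply: (mulfI P10); rewrite mulrBr.
(* [Z2] is u rho(y) and [Z3] the prefactor on the right. Their products with P1 are v P2 and v P3,
   so the claim times P1 is v times [EQ]. *)
set Z2 := u * _; set Z3 := (X in _ = P1 * (X * T3)).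
have Z2E : P1 * Z2 = v * P2.
  rewrite /P1 /Z2 /P2 R3 R4 R5 R6.
  by field; rewrite ?H0 ?n4 ?n38 ?n39 ?n28 ?n29 ?n1 ?n5 ?n30 ?m1.
have Z3E : P1 * Z3 = v * P3.
  rewrite /P1 /Z3 /P3 R4 R5 R7.
  by field; do ?[apply/andP; split]; rewrite ?H0.
clear - EQ Z2E Z3E; clearbody P1 P2 P3 Z2 Z3.
transitivity (v * (P1 * T1) - P1 * Z2 * T2); first by ring.
rewrite Z2E; transitivity (v * (P1 * T1 - P2 * T2)); first by ring.
rewrite EQ; transitivity (v * P3 * T3); first by ring.
by rewrite -Z3E; ring.
Qed.

End Evaluation.

Theorem theorem3 (R : realType) (q a c u v x y : R[i])
  (q_gt0 : 0 < `|q|) (q_lt1 : `|q| < 1)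
  (qvy_lt1 : `|q * v / y| < 1) (u_lt1 : `|u| < 1)
  (qcu_lt1 : `|q / (c * u)| < 1)
  (* well-definedness of all the expressions that occur *)
  (a_neq0 : a != 0) (c_neq0 : c != 0) (u_neq0 : u != 0) (v_neq0 : v != 0)
  (x_neq0 : x != 0) (y_neq0 : y != 0)
  (rho_ok : rho_den q a c u v x y != 0)
  (omega_ok1 : c * u - 1 != 0) (omega_ok2 : omega_den q c u v x y != 0)
  (lhs1_ok1 : forall k : nat, lhs1_den1 q a c v k != 0)
  (lhs1_ok2 : forall k : nat, lhs1_den2 q a c u v x y k != 0)
  (lhs2_ok1 : forall k : nat, lhs2_den1 q a c u y k != 0)
  (lhs2_ok2 : forall k : nat, lhs2_den2 q a c u v x y k != 0)
  (rhs_ok : rhs_den q a c u v x y != 0)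
  (W87_ok : forall k : nat,
     W87_den (x * u / (y * c * v)) (q / y) (x * u / y) (x / (a * c * v ^+ 2))
       u (a * u) q k != 0) :
  [/\ summable_seq (lhs1_term q a c u v x y),
      summable_seq (lhs2_term q a c u v x y),
      summable_seq (W87_term (x * u / (y * c * v)) (q / y) (x * u / y)
        (x / (a * c * v ^+ 2)) u (a * u) q (q / (c * u)))
    & v * sumoo (lhs1_term q a c u v x y)
      - u * rho q a c u v x y * sumoo (lhs2_term q a c u v x y)
      = omega q c u v x y * rhs_num q a c u v x y / rhs_den q a c u v x y
        * W87 (x * u / (y * c * v)) (q / y) (x * u / y) (x / (a * c * v ^+ 2))
            u (a * u) q (q / (c * u))].
Proof.
exact: (three_term_relation (@complex_geo_complete R)).
Qed.
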